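(* Let $\Omega\subset\mathbb{R}^3$ be a bounded domain with analytic boundary that is star-shaped with respect to a ball, let $V=H^1(\Omega)$, let $S\subset V$ be a closed subspace, and let $\zeta\in\mathbb{C}$ with $|\zeta|\ge1$ and $\operatorname{Re}\zeta>0$. Then the Galerkin method based on $S$ is quasi-optimal, i.e., for every $u\in V$ there exists a unique $u_S\in S$ with $a_\zeta(u-u_S,v)=0$ for all $v\in S$, and $$\|u-u_S\|_{|\zeta|}\le\frac{|\zeta|}{\operatorname{Re}\zeta}(1+C_b)\inf_{v\in S}\|u-v\|_{|\zeta|},$$ $$\|u-u_S\|_{L^2(\Omega)}\le(1+C_b)\,\eta(S)\,\|u-u_S\|_{|\zeta|}.$$
   Context: All functions are complex-valued; $(\cdot,\cdot)$, $\|\cdot\|$ are the $L^2(\Omega)$ scalar product (conjugate-linear in the second argument) and norm, $(\cdot,\cdot)_\Gamma$ the $L^2(\Gamma)$ scalar product, $\Gamma=\partial\Omega$ (traces understood). $a_\zeta(u,v):=(\nabla u,\nabla v)+\zeta^2(u,v)+\zeta(u,v)_\Gamma$ on $V\times V$; $\|u\|_\rho:=(\|\nabla u\|^2+\rho^2\|u\|^2)^{1/2}$. $C_b$ is a constant, independent of $\zeta$, such that $|\zeta(u,v)_\Gamma|\le C_b\|u\|_{|\zeta|}\|v\|_{|\zeta|}$, and hence $|a_\zeta(u,v)|\le(1+C_b)\|u\|_{|\zeta|}\|v\|_{|\zeta|}$, for all $u,v\in V$ and all $\zeta$ with $\operatorname{Re}\zeta\ge0$, $|\zeta|\ge1$.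 For $f\in L^2(\Omega)$, $\tilde S_\zeta f:=z\in V$ denotes the unique solution of the adjoint problem $a_{\overline\zeta}(z,w)=(f,w)$ for all $w\in V$. The adjoint approximability is $$\eta(S):=\sup_{f\in L^2(\Omega)\setminus\{0\}}\ \inf_{v\in S}\frac{\|\tilde S_\zeta f-v\|_{|\zeta|}}{\|f\|}.$$ *)

(* Defs.v *)
From HB Require Import structures.
From mathcomp Require Import all_boot all_order all_algebra.
From mathcomp Require Import all_classical all_reals all_analysis.
From mathcomp Require Import complex.

Set Implicit Arguments.
Unset Strict Implicit.
Unset Printing Implicit Defensive.

Import Order.TTheory GRing.Theory Num.Theory.
Import numFieldNormedType.Exports.

Local Open Scope classical_set_scope.
Local Open Scope ring_scope.
Local Open Scope complex_scope.

(** ** Square-integrable complex functions *)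

(* [ComplexField.Normc.normc] is the R-valued modulus, whereas [`|z|] is
   R[i]-valued. *)
Notation cabs := ComplexField.Normc.normc.

Section L2.
Context (R : realType) (d : measure_display) (T : measurableType d).
Variables (mu : {measure set T -> \bar R}) (D : set T).
Implicit Types f g : T -> R[i].

Definition cintegral f : R[i] :=
  Rintegral mu D (fun x => complex.Re (f x))
    +i* Rintegral mu D (fun x => complex.Im (f x)).

Definition isL2 f : Prop :=
  [/\ measurable_fun D (fun x => complex.Re (f x)),
      measurable_fun D (fun x => complex.Im (f x))
    & (\int[mu]_(x in D) ((cabs (f x) ^+ 2)%:E) < +oo)%E].

Definition L2dot f g : R[i] := cintegral (fun x => f x * (g x)^*).

Definition L2norm f : R := Num.sqrt (Rintegral mu D (fun x => cabs (f x) ^+ 2)).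

End L2.

(** ** Euclidean 3-space *)

Notation R3 R := (R * R * R)%type.

(* Convertible to [R3 R], but carrying the Borel sigma-algebra. *)
Notation R3meas R :=
  (measurableTypeR R * measurableTypeR R * measurableTypeR R)%type.

Definition leb3 (R : realType) : {measure set (R3meas R) -> \bar R} :=
  ((@lebesgue_measure R \x @lebesgue_measure R) \x @lebesgue_measure R)%E.

Section Geometry.
Context {R : realType}.
Implicit Types (x y p : R3 R) (Omega : set (R3 R)).

(* The library norm on a product is the maximum norm. *)
Definition edist x y : R :=
  Num.sqrt ((x.1.1 - y.1.1) ^+ 2 + (x.1.2 - y.1.2) ^+ 2 + (x.2 - y.2) ^+ 2).

Definition eball p (r : R) : set (R3 R) := [set x | edist p x < r].

Definition frontier Omega : set (R3 R) := closure Omega `\` Omega°.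

Definition bounded_domain Omega : Prop :=
  [/\ Omega !=set0, open Omega, connected Omega & bounded_set Omega].

(* For convex B, the convex hull of {x} U B is the union of the segments from
   x to the points of B. *)
Definition star_shaped_wrt_ball Omega : Prop :=
  exists c r, 0 < r /\
    forall x y (t : R), Omega x -> eball c r y -> 0 <= t <= 1 ->
      Omega ((1 - t) *: x + t *: y).

(* On a square around p, g is the sum of an absolutely convergent double power
   series in the displacement h from p. *)
Definition real_analytic_at (g : R * R -> R) (p : R * R) : Prop :=
  exists (c : nat -> nat -> R) (r : R), 0 < r /\
    forall h : R * R, `|h.1| < r -> `|h.2| < r ->
      (exists M : R, forall n,
         \sum_(i < n) \sum_(j < n) `|c i j * h.1 ^+ i * h.2 ^+ j| <= M) /\
      (fun n => \sum_(i < n) \sum_(j < n) c i j * h.1 ^+ i * h.2 ^+ j) @ \oo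
        --> g (p.1 + h.1, p.2 + h.2).

(* Up to a Euclidean isometry, Omega is locally the strict epigraph of a real
   analytic function of two variables. *)
Definition analytic_boundary Omega : Prop :=
  forall p, frontier Omega p ->
    exists (r : R) (F : R3 R -> R3 R) (g : R * R -> R),
      [/\ 0 < r,
          forall x y, edist (F x) (F y) = edist x y,
          forall x, eball p r x -> real_analytic_at g (F x).1
        & forall x, eball p r x -> (Omega x <-> g (F x).1 < (F x).2)].

End Geometry.

(** ** Surface measure: two-dimensional Hausdorff measure *)

Section Surface.
Context {R : realType}.

Definition diam (A : set (R3 R)) : R :=
  sup [set s | exists x y, [/\ A x, A y & s = edist x y]].

(* The infinite value excludes sets of diameter greater than [delta] from
   coverings. Coverings are by Borel sets, which gives the same measure as
   arbitrary coverings since a set and its closure have the same diameter. *)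
Definition gauge2 (delta : R) (A : set (R3meas R)) : \bar R :=
  if `[< forall x y, A x -> A y -> edist x y <= delta >]
  then (pi / 4 * diam A ^+ 2)%:E else +oo%E.

Definition hausdorff2 (A : set (R3 R)) : \bar R :=
  ereal_sup [set mu_ext (gauge2 delta) A | delta in [set delta : R | 0 < delta]].

Definition surface (Gamma A : set (R3meas R)) : \bar R :=
  hausdorff2 (A `&` Gamma).

Lemma gauge2_ge0 delta A : (0 <= gauge2 delta A)%E.
Proof.
rewrite /gauge2; case: ifP => // _; rewrite lee_fin.
by rewrite mulr_ge0 ?sqr_ge0 ?divr_ge0 ?pi_ge0.
Qed.

Lemma gauge2_set0 delta : gauge2 delta set0 = 0%E.
Proof.
rewrite /gauge2; case: asboolP => [_|]; last by case=> x y [].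
rewrite /diam (_ : [set s | _] = set0) ?sup0 ?expr0n ?mulr0//.
by apply/seteqP; split => // s [x [y []]].
Qed.

Section Outer.
Variable Gamma : set (R3meas R).

Lemma surface0 : surface Gamma set0 = 0%E.
Proof.
rewrite /surface /hausdorff2 set0I.
rewrite (_ : [set _ | _ in _] = [set 0%E]) ?ereal_sup1//.
apply/seteqP; split => [_ [delta _ <-]|_ ->] /=.
  by rewrite mu_ext0//; [exact: gauge2_set0|exact: gauge2_ge0].
exists 1 => //=.
by rewrite mu_ext0//; [exact: gauge2_set0|exact: gauge2_ge0].
Qed.

Lemma surface_ge0 A : (0 <= surface Gamma A)%E.
Proof.
apply: le_ereal_sup_tmp; exists (mu_ext (gauge2 1) (A `&` Gamma)).
  by exists 1 => /=.
by apply: mu_ext_ge0; exact: gauge2_ge0.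
Qed.

Lemma le_surface : {homo surface Gamma : A B / A `<=` B >-> (A <= B)%E}.
Proof.
move=> A B AB; apply: ge_ereal_sup => _ [delta d0 <-].
apply: le_ereal_sup_tmp; exists (mu_ext (gauge2 delta) (B `&` Gamma)).
  by exists delta.
by apply: le_mu_ext; exact: setSI.
Qed.

Lemma surface_sigma_subadditive : sigma_subadditive (surface Gamma).
Proof.
move=> F; apply: ge_ereal_sup => _ [delta d0 <-].
rewrite setI_bigcupl.
apply: le_trans (mu_ext_sigma_subadditive (@gauge2_ge0 delta) _) _.
apply: lee_nneseries => [n _ _|n _].
  by apply: mu_ext_ge0; exact: gauge2_ge0.
by apply: ereal_sup_ubound; exists delta.
Qed.

HB.instance Definition _ := isOuterMeasure.Build R (R3meas R) (surface Gamma)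
  surface0 surface_ge0 le_surface surface_sigma_subadditive.

(* Restricting to [Gamma] before applying Caratheodory's construction makes
   [Gamma] conull, so that integrals over the whole space are integrals over
   [Gamma]. *)
Definition surface_outer : {outer_measure set (R3meas R) -> \bar R} :=
  surface Gamma.

Definition surface_measure :
    {measure set (caratheodory_type surface_outer) -> \bar R} :=
  (surface_outer : set (caratheodory_type surface_outer) -> \bar R).

End Outer.
End Surface.

(** ** The Sobolev space H^1 *)

Section Sobolev.
Context {R : realType}.
Variable Omega : set (R3 R).
Implicit Types (u v f g z : R3 R -> R[i]) (phi : R3 R -> R) (i : 'I_3).

Definition unit_vector i : R3 R :=
  ((i == 0 :> nat)%:R, (i == 1 :> nat)%:R, (i == 2 :> nat)%:R).

Definition partial i phi : R3 R -> R := fun x => 'D_(unit_vector i) phi x.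

(* Every iterated partial derivative is Frechet differentiable. *)
Definition smooth phi : Prop :=
  forall (s : seq 'I_3) x, differentiable (foldr partial phi s) x.

Definition test_function phi : Prop :=
  smooth phi /\ exists K : set (R3 R),
    [/\ compact K, K `<=` Omega & forall x, ~ K x -> phi x = 0].

Definition L2_Omega u : Prop := isL2 (@leb3 R) Omega u.
Definition dot u v : R[i] := L2dot (@leb3 R) Omega u v.
Definition norm u : R := L2norm (@leb3 R) Omega u.

(* Real-valued test functions suffice, by linearity. *)
Definition is_weak_partial i u g : Prop :=
  L2_Omega g /\
  forall phi, test_function phi ->
    cintegral (@leb3 R) Omega (fun x => u x * (partial i phi x)%:C) =
    - cintegral (@leb3 R) Omega (fun x => g x * (phi x)%:C).

Definition H1 u : Prop := L2_Omega u /\ forall i, exists g, is_weak_partial i u g.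

(* Determined up to equality almost everywhere on [Omega] when [H1 u]. *)
Definition weak_partial i u : R3 R -> R[i] :=
  xget (fun=> 0) [set g | is_weak_partial i u g].

Definition gdot u v : R[i] := \sum_(i < 3) dot (weak_partial i u) (weak_partial i v).

Definition rho_norm (rho : R) u : R :=
  Num.sqrt (\sum_(i < 3) norm (weak_partial i u) ^+ 2 + rho ^+ 2 * norm u ^+ 2).

(* Functions are representatives of their classes modulo equality almost
   everywhere; closedness makes a closed subspace a union of such classes. *)
Definition closed_subspace (S : set (R3 R -> R[i])) : Prop :=
  [/\ S `<=` H1,
      S (fun=> 0),
      forall (a : R[i]) u v, S u -> S v -> S (fun x => a * u x + v x)
    & forall u, H1 u ->
        (forall eps : R, 0 < eps ->
           exists2 v, S v & rho_norm 1 (fun x => u x - v x) < eps) -> S u].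

(** ** Traces *)

Notation Gamma := (frontier Omega).

Definition L2_Gamma u : Prop := isL2 (surface_measure Gamma) setT u.
Definition dot_Gamma u v : R[i] := L2dot (surface_measure Gamma) setT u v.
Definition norm_Gamma u : R := L2norm (surface_measure Gamma) setT u.

Definition ae_eq_Gamma u v : Prop := {ae surface_measure Gamma, forall x, u x = v x}.
Definition ae_eq_Omega u v : Prop :=
  {ae @leb3 R, forall x, Omega x -> u x = v x}.

(* The bounded linear map from H^1(Omega) to L^2(Gamma) extending restriction of
   functions continuous on the closure of [Omega]. *)
Definition trace_operator (tr : (R3 R -> R[i]) -> (R3 R -> R[i])) : Prop :=
  [/\ forall u, H1 u -> L2_Gamma (tr u),
      forall (a : R[i]) u v, H1 u -> H1 v ->
        ae_eq_Gamma (tr (fun x => a * u x + v x)) (fun x => a * tr u x + tr v x),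
      exists C : R, forall u, H1 u -> norm_Gamma (tr u) <= C * rho_norm 1 u
    & forall u, H1 u ->
        {within closure Omega, continuous (fun x => complex.Re (u x))} ->
        {within closure Omega, continuous (fun x => complex.Im (u x))} ->
        ae_eq_Gamma (tr u) u].

(** ** The sesquilinear form and the Galerkin method *)

Variable tr : (R3 R -> R[i]) -> (R3 R -> R[i]).
Variable zeta : R[i].

Definition aform (w : R[i]) u v : R[i] :=
  gdot u v + w ^+ 2 * dot u v + w * dot_Gamma (tr u) (tr v).

Definition adjoint_solution f z : Prop :=
  H1 z /\ forall w, H1 w -> aform zeta^* z w = dot f w.

Definition Stilde f : R3 R -> R[i] := xget (fun=> 0) [set z | adjoint_solution f z].

Definition best_error (S : set (R3 R -> R[i])) u : R :=
  inf [set rho_norm (cabs zeta) (fun x => u x - v x) | v in S].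

(* The nonzero elements of L^2(Omega) are those of nonzero norm. *)
Definition adjoint_approximability (S : set (R3 R -> R[i])) : \bar R :=
  ereal_sup [set (best_error S (Stilde f) / norm f)%:E |
             f in [set f | L2_Omega f /\ norm f != 0]].

Definition galerkin_solution (S : set (R3 R -> R[i])) u uS : Prop :=
  S uS /\ forall v, S v -> aform zeta (fun x => u x - uS x) v = 0.

End Sobolev.

(* Main.v *)
(** Multiplied by the conjugate of zeta, the form becomes coercive on H^1:
    Re (conj zeta * a(u, u)) >= Re zeta * |u|^2 in the |zeta|-weighted norm.
    Lax-Milgram on the closed subspace S and Galerkin orthogonality then give
    existence, uniqueness and the quasi-optimality constant (Cea); the L^2
    estimate is the Aubin-Nitsche duality argument, testing the adjoint problem
    for the error against the error.

    What this needs from analysis is that H^1, defined through weak partial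
    derivatives of representatives, is a Hilbert space modulo null functions:
    L^2 is complete (Riesz-Fischer), and weak derivatives are unique almost
    everywhere.  Uniqueness is the fundamental lemma of the calculus of
    variations, proved with test functions that are products of exp (-1 / t)
    evaluated at affine functions of one coordinate.  Such products, dilated,
    converge pointwise to indicators of octants, and octants form a pi-system
    generating the Borel sets.

    No nonzero element of H^1 has to be exhibited, hence no integration by parts
    is needed: 0 <= Cb matters only when some element has nonzero norm. *)

(* Functions are never identified almost everywhere, so every space carries only a seminorm. Riesz
   representers, limits and [weak_partial] are determined up to null functions and need not depend
   linearly on their data. Linearity is therefore used inside pairings, where a null error
   disappears by Cauchy-Schwarz, and existence comes from sequences whose increments decay
   geometrically; hence completeness is stated for sequences with summable increments.

   The conjugate of zeta is the right multiplier because it turns [z ^+ 2] into [|z|^2 z] and [z]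
   into [|z|^2]: the two volume terms recombine into [Re z] times the squared weighted norm, and the
   boundary term becomes nonnegative. The modulus of this multiplier is the numerator of the
   constant [|zeta| / Re zeta]. *)
Require Import Defs.
From mathcomp Require Import all_boot all_order all_algebra.
From mathcomp Require Import all_classical all_reals all_analysis.
From mathcomp Require Import measurable_realfun complex ring lra.
Set Implicit Arguments.
Unset Strict Implicit.
Unset Printing Implicit Defensive.
Import Order.TTheory GRing.Theory Num.Theory.
Import numFieldNormedType.Exports.
Local Open Scope classical_set_scope.
Local Open Scope ring_scope.
Local Open Scope complex_scope.

(** * Lax-Milgram in a complete semi-inner product space *)

Section LaxMilgram.
Context {R : realType} {V : lmodType R}.
Variables (S : set V) (ip : V -> V -> R).
Implicit Types (u v w r : V) (F : V -> R) (b : V -> V -> R).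

(** Linearity is required on [S] only: integrals and chosen weak derivatives are additive just for
    functions on which they make sense. *)
Definition linear_on F :=
  forall a u v, S u -> S v -> F (a *: u + v) = a * F u + F v.

Definition bilinear_on b :=
  (forall w, S w -> linear_on (b^~ w)) /\ (forall w, S w -> linear_on (b w)).

Definition seminorm u := Num.sqrt (ip u u).

Hypothesis S0 : S 0.
Hypothesis SD : forall a u v, S u -> S v -> S (a *: u + v).
Hypothesis ipb : bilinear_on ip.
Hypothesis ipC : forall u v, S u -> S v -> ip u v = ip v u.
Hypothesis ip_ge0 : forall u, S u -> 0 <= ip u u.
(** Summable increments are what both iterations below produce, and they let Riesz-Fischer proceed
    without extracting a subsequence. The limit is any element at vanishing distance; it need not be
    unique. *)
Hypothesis S_complete : forall x : nat -> V, (forall n, S (x n)) ->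
  (exists M, forall n, \sum_(k < n) seminorm (x k.+1 - x k) <= M) ->
  exists2 l, S l & (fun n => seminorm (x n - l)) @ \oo --> 0.

Lemma linear_on0 F : linear_on F -> F 0 = 0.
Proof.
move=> F_lin; have := F_lin (-1) 0 0 S0 S0.
by rewrite scaler0 add0r mulN1r addNr.
Qed.

Lemma linear_onZ F a u : linear_on F -> S u -> F (a *: u) = a * F u.
Proof. by move=> Fl Su; rewrite -[a *: u]addr0 Fl// linear_on0// addr0. Qed.

Lemma linear_onB F u v : linear_on F -> S u -> S v -> F (u - v) = F u - F v.
Proof. by move=> Fl Su Sv; rewrite addrC -scaleN1r Fl// mulN1r addrC. Qed.

Lemma subspaceZ a u : S u -> S (a *: u).
Proof. by move=> Su; rewrite -[a *: u]addr0; exact: SD. Qed.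

Lemma subspaceB u v : S u -> S v -> S (u - v).
Proof. by move=> Su Sv; rewrite addrC -scaleN1r; exact: SD. Qed.

Lemma seminorm_ge0 u : 0 <= seminorm u.
Proof. exact: sqrtr_ge0. Qed.

Lemma seminorm_sqr u : S u -> seminorm u ^+ 2 = ip u u.
Proof. by move=> Su; rewrite sqr_sqrtr// ip_ge0. Qed.

Lemma seminormZ a u : S u -> seminorm (a *: u) = `|a| * seminorm u.
Proof.
move=> Su; have [ipl ipr] := ipb; have SaU := subspaceZ a Su.
rewrite /seminorm (linear_onZ _ (ipl _ SaU))// (linear_onZ _ (ipr _ Su))//.
by rewrite mulrA -expr2 sqrtrM ?sqr_ge0// sqrtr_sqr.
Qed.

Lemma bilinear_on_sqr b c u v : bilinear_on b -> S u -> S v ->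
  b (c *: u + v) (c *: u + v) =
  c ^+ 2 * b u u + c * (b u v + b v u) + b v v.
Proof.
move=> [bl br] Su Sv; have Sc := SD c Su Sv.
by rewrite (bl _ Sc)// (br _ Su)// (br _ Sv)//; ring.
Qed.

Lemma ip_CauchySchwarz u v : S u -> S v ->
  `|ip u v| <= seminorm u * seminorm v.
Proof.
move=> Su Sv; rewrite -ler_sqr ?nnegrE ?mulr_ge0 ?seminorm_ge0//.
rewrite exprMn !seminorm_sqr// real_normK ?num_real//.
have P c : 0 <= c ^+ 2 * ip u u + c * (ip u v *+ 2) + ip v v.
  by have := ip_ge0 (SD c Su Sv); rewrite bilinear_on_sqr// [ip v u]ipC// mulr2n.
have := ip_ge0 Su; rewrite le_eqVlt => /orP[/eqP u0|u_gt0].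
  rewrite -u0 mul0r; have [->|uv0] := eqVneq (ip u v) 0; first by rewrite expr0n.
  (* For a null [u] the quadratic degenerates to an affine function of [c], and this [c] would give
     it the value -1. *)
  have := P (- (ip v v + 1) / (ip u v *+ 2)); rewrite -u0 mulr0 add0r divfK.
    by lra.
  by rewrite mulrn_eq0.
have := P (- ip u v / ip u u).
have -> : (- ip u v / ip u u) ^+ 2 * ip u u +
   - ip u v / ip u u * (ip u v *+ 2) + ip v v =
   (ip u u * ip v v - ip u v ^+ 2) / ip u u by field; rewrite gt_eqF.
by rewrite pmulr_lge0 ?invr_gt0// subr_ge0.
Qed.

Lemma seminormD u v : S u -> S v -> seminorm (u + v) <= seminorm u + seminorm v.
Proof.
move=> Su Sv; have SuD : S (u + v) by rewrite -[u]scale1r; exact: SD.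
rewrite -ler_sqr ?nnegrE ?addr_ge0 ?seminorm_ge0// seminorm_sqr// sqrrD.
rewrite !seminorm_sqr// -{1 2}[u]scale1r bilinear_on_sqr// [ip v u]ipC//.
have := ip_CauchySchwarz Su Sv; rewrite ler_norml => /andP[_]; lra.
Qed.

Lemma eq0_le_cvg0 (a : R) (e : nat -> R) :
  e @ \oo --> 0 -> (forall n, `|a| <= e n) -> a = 0.
Proof.
move=> e0 ae; apply/normr0_eq0/le_anti; rewrite normr_ge0 andbT.
by rewrite -(cvg_lim _ e0)//; apply: limr_ge; [exact: cvgP e0|exact: nearW].
Qed.

Lemma geometric_partial_sum_le (c q : R) n : 0 <= c -> 0 <= q < 1 ->
  \sum_(k < n) c * q ^+ k <= c / (1 - q).
Proof.
move=> c0 /andP[q0 q1]; rewrite -mulr_sumr ler_wpM2l//.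
have := subrXX 1 q n; rewrite expr1n.
under eq_bigr do rewrite expr1n mul1r.
move=> E; rewrite -(@ler_pM2l _ (1 - q)) ?subr_gt0// -E divff ?gt_eqF ?subr_gt0//.
by rewrite gerBl exprn_ge0.
Qed.

(** Minimises the quadratic functional [J], bounded below because [F] is bounded by the seminorm.
    The parallelogram identity makes near-minimisers close to one another, and the Euler-Lagrange
    equation is read off from near-minimality along the sequence. *)
Lemma riesz F M : linear_on F -> (forall v, S v -> `|F v| <= M * seminorm v) ->
  exists2 r, S r & forall v, S v -> F v = ip r v.
Proof.
move=> Fl FM; have [ipl ipr] := ipb.
pose J v := ip v v - 2 * F v.
have J_ge v : S v -> - M ^+ 2 <= J v.
  move=> Sv; rewrite /J -seminorm_sqr//.
  have := FM _ Sv; rewrite ler_norml => /andP[_].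
  have := sqr_ge0 (seminorm v - M); rewrite sqrrB; lra.
have hasJ : has_inf [set J v | v in S].
  split; first by exists (J 0), 0.
  by exists (- M ^+ 2) => _ [v Sv <-]; exact: J_ge.
pose m := inf [set J v | v in S].
have m_le v : S v -> m <= J v by move=> Sv; apply: ge_inf; [case: hasJ|exists v].
(* Errors of order [4^-n] in [J] become distances of order [2^-n], which are summable. *)
have /choice[x xP] : forall n, exists v, S v /\ J v < m + (4^-1) ^+ n.
  move=> n; have e0 : 0 < (4^-1 : R) ^+ n by rewrite exprn_gt0.
  by have [_ [v Sv <-] lt] := inf_adherent e0 hasJ; exists v.
have Sx n : S (x n) by have [] := xP n.
have Jx n : J (x n) < m + (4^-1) ^+ n by have [] := xP n.
have e2 n : (4^-1 : R) ^+ n = (2^-1 ^+ n) ^+ 2.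
  by rewrite -exprM mulnC exprM; congr (_ ^+ _); rewrite expr2 -invfM -natrM.
have incr n : seminorm (x n.+1 - x n) <= 2 * 2^-1 ^+ n.
  rewrite -ler_sqr ?nnegrE ?mulr_ge0 ?exprn_ge0 ?seminorm_ge0//.
  rewrite seminorm_sqr; last exact: subspaceB.
  have -> : x n.+1 - x n = -1 *: x n + x n.+1 by rewrite scaleN1r addrC.
  (* Parallelogram identity: the squared distance is [2 * J (x n.+1) + 2 * J (x n)] minus four times
     [J] at the midpoint, where [J] is at least [m]. *)
  have := m_le _ (subspaceZ (2^-1) (SD 1 (Sx n.+1) (Sx n))).
  rewrite /J (linear_onZ _ (ipl _ _)) ?(linear_onZ _ (ipr _ _)) ?(linear_onZ _ Fl)//;
    try by [exact: SD | exact/subspaceZ/SD].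
  rewrite bilinear_on_sqr// Fl//.
  rewrite bilinear_on_sqr// [ip (x n) (x n.+1)]ipC// exprMn -e2.
  have := Jx n; have := Jx n.+1; rewrite /J exprS.
  have : 0 < (4^-1 : R) ^+ n by rewrite exprn_gt0.
  rewrite exprS; lra.
have [|l Sl xl] := S_complete Sx.
  exists (2 / (1 - 2^-1)) => n.
  apply: (@le_trans _ _ (\sum_(k < n) 2 * 2^-1 ^+ k)).
    by apply: ler_sum => k _; exact: incr.
  by apply: geometric_partial_sum_le => //; lra.
exists l => // v Sv; apply/eqP; rewrite -subr_eq0; apply/eqP.
apply: (@eq0_le_cvg0 _ (fun n => 2^-1 ^+ n * (ip v v + 1) +
    seminorm (x n - l) * seminorm v)).
  have -> : 0 = 0 * (ip v v + 1) + 0 * seminorm v by rewrite !mul0r addr0.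
  apply: cvgD; apply: cvgMr_tmp => //; apply: cvg_expr.
  by rewrite ger0_norm; lra.
move=> n.
have -> : F v - ip l v = - (ip (x n) v - F v) + ip (x n - l) v.
  by rewrite (linear_onB (ipl v Sv))//; lra.
apply: le_trans (ler_normD _ _) _; rewrite lerD//; last first.
  by apply: ip_CauchySchwarz => //; exact: subspaceB.
rewrite normrN; set D := ip (x n) v - F v.
(* [D *+ 2] is the derivative of [J] at [x n] along [v], and [J] can drop by at most [4^-n] from
   there. The steps [t = 2^-n] and [t = - 2^-n] then bound [D] by a multiple of [2^-n]. *)
have P t : 0 <= t ^+ 2 * ip v v + t * (D *+ 2) + (2^-1 ^+ n) ^+ 2.
  have := m_le _ (SD t Sv (Sx n)); have := Jx n; rewrite -e2 /J /D.
  by rewrite bilinear_on_sqr// Fl// [ip v (x n)]ipC// !mulr2n; lra.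
have h0 : 0 < (2^-1 : R) ^+ n by rewrite exprn_gt0.
have v0 := ip_ge0 Sv.
rewrite ler_norml; have := P (2^-1 ^+ n); have := P (- 2^-1 ^+ n).
rewrite sqrrN mulr2n; set h := 2^-1 ^+ n in h0 *; move=> A B.
have {}A : 0 <= h * (h * ip v v - (D + D) + h) by rewrite !expr2 in A; lra.
have {}B : 0 <= h * (h * ip v v + (D + D) + h) by rewrite !expr2 in B; lra.
rewrite !(pmulr_rge0 _ h0) in A B.
have := mulr_ge0 (ltW h0) v0; lra.
Qed.

(* Richardson iteration [u + theta * r], where [r] represents the residual
   [F - b u]; its ratio is [sqrt (1 - (alpha / K) ^+ 2)] for [theta = alpha / K ^+ 2]
   with [K = |M| + alpha]. *)
Lemma lax_milgram b F alpha M N : bilinear_on b -> linear_on F -> 0 < alpha ->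
  (forall u, S u -> alpha * seminorm u ^+ 2 <= b u u) ->
  (forall u v, S u -> S v -> `|b u v| <= M * seminorm u * seminorm v) ->
  (forall v, S v -> `|F v| <= N * seminorm v) ->
  exists2 u, S u & forall v, S v -> b u v = F v.
Proof.
move=> [bl br] Fl a0 coercive bM FN; have [ipl ipr] := ipb.
(* [T u] represents [b u] when [u] is in [S] and is arbitrary otherwise. Representers being unique
   only up to null vectors, [T] need not be linear. *)
have /choice[T TP] : forall u, exists r, S u ->
    S r /\ forall v, S v -> b u v = ip r v.
  move=> u; have [Su|] := pselect (S u); last by exists u.
  have [r Sr rP] := riesz (br u Su) (fun v Sv => bM u v Su Sv).
  by exists r.
have [f Sf fP] := riesz Fl FN.
(* [M] may be negative or below [alpha] when the seminorm vanishes on [S]; this [K] is positive with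
   [alpha / K <= 1] in every case, so that [q] lies in [[0, 1)]. *)
pose K := `|M| + alpha.
have K0 : 0 < K by rewrite ltr_wpDl.
have T_le u : S u -> seminorm (T u) <= K * seminorm u.
  move=> Su; have [STu TuP] := TP u Su.
  have [->|Tu0] := eqVneq (seminorm (T u)) 0.
    by rewrite mulr_ge0 ?seminorm_ge0 ?ltW.
  have Tu_gt0 : 0 < seminorm (T u) by rewrite lt_def Tu0 seminorm_ge0.
  rewrite -(ler_pM2r Tu_gt0) -expr2 seminorm_sqr// -TuP//.
  apply: le_trans (ler_norm _) _; apply: le_trans (bM _ _ Su STu) _.
  rewrite !ler_wpM2r ?seminorm_ge0//; have := ler_norm M; rewrite /K; lra.
pose theta := alpha / K ^+ 2.
have theta0 : 0 < theta by rewrite divr_gt0 ?exprn_gt0.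
pose step u := theta *: (f - T u) + u.
pose x n := iter n step 0.
have Sr u : S u -> S (f - T u).
  by move=> Su; have [STu _] := TP u Su; exact: subspaceB.
have Sx n : S (x n).
  by elim: n => [|n IH] //=; apply: SD => //; exact: Sr.
pose q := Num.sqrt (1 - (alpha / K) ^+ 2).
have aK : 0 < alpha / K <= 1.
  by rewrite divr_gt0//= ler_pdivrMr// mul1r /K lerDr.
have q2 : q ^+ 2 = 1 - (alpha / K) ^+ 2.
  rewrite sqr_sqrtr// subr_ge0; case/andP: aK => h0 h1.
  by rewrite expr_le1// ltW.
have q01 : 0 <= q < 1.
  rewrite sqrtr_ge0/= -[ltRHS]sqrtr1 ltr_sqrt// gtrBl exprn_gt0//.
  by case/andP: aK.
have q0 : 0 <= q by case/andP: q01.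
have contract u : S u ->
    seminorm (f - T (step u)) <= q * seminorm (f - T u).
  move=> Su; have [STu TuP] := TP u Su.
  set r := f - T u; have Sru : S r by exact: Sr.
  have Ss : S (step u) by exact: SD.
  have [STs TsP] := TP _ Ss; have [STr TrP] := TP _ Sru.
  set w := f - T (step u); have Sw : S w by exact: subspaceB.
  have Sd : S (- theta *: T r + r) by exact: SD.
  (* Since [T] need not be linear, [w] and [r - theta *: T r] are compared only through pairings
     with elements of [S]; pairing with [w] itself bounds [seminorm w] by Cauchy-Schwarz. *)
  have w_eq : ip w w = ip (- theta *: T r + r) w.
    rewrite (ipl w Sw)// -TrP// {1}/w (linear_onB (ipl _ Sw))// -TsP// -fP//.
    rewrite /r (linear_onB (ipl w Sw))// -TuP// -fP// /step bl//; lra.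
  have [->|w0] := eqVneq (seminorm w) 0; first by rewrite mulr_ge0 ?seminorm_ge0.
  have w_gt0 : 0 < seminorm w by rewrite lt_def w0 seminorm_ge0.
  apply: (@le_trans _ _ (seminorm (- theta *: T r + r))).
    rewrite -(ler_pM2r w_gt0) -expr2 seminorm_sqr// w_eq.
    by apply: le_trans (ler_norm _) _; exact: ip_CauchySchwarz.
  rewrite -ler_sqr ?nnegrE ?mulr_ge0 ?seminorm_ge0// seminorm_sqr// exprMn.
  rewrite bilinear_on_sqr// [ip r (T r)]ipC// -(TrP r)// q2 -!seminorm_sqr//.
  have br2 := coercive _ Sru; rewrite sqrrN.
  have Tr2 : seminorm (T r) ^+ 2 <= K ^+ 2 * seminorm r ^+ 2.
    by rewrite -exprMn ler_sqr ?nnegrE ?mulr_ge0 ?seminorm_ge0 ?T_le ?ltW.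
  have {}Tr2 := ler_wpM2l (sqr_ge0 theta) Tr2.
  have {}br2 := ler_wpM2l (ltW theta0) br2.
  have -> : (1 - (alpha / K) ^+ 2) * seminorm r ^+ 2 =
     theta ^+ 2 * (K ^+ 2 * seminorm r ^+ 2) -
     2 * (theta * (alpha * seminorm r ^+ 2)) + seminorm r ^+ 2.
    by rewrite /theta; field; rewrite gt_eqF.
  lra.
pose C := seminorm (f - T 0).
have res_le n : seminorm (f - T (x n)) <= C * q ^+ n.
  elim: n => [|n IH]; first by rewrite expr0 mulr1.
  apply: le_trans (contract _ (Sx n)) _.
  by rewrite exprS mulrCA ler_wpM2l.
have res0 : (fun n => C * q ^+ n) @ \oo --> 0.
  rewrite -[0](mulr0 C); apply: cvgMl_tmp; apply: cvg_expr.
  by rewrite ger0_norm; case/andP: q01.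
have [|l Sl xl] := S_complete Sx.
  exists (theta * C / (1 - q)) => n.
  apply: (@le_trans _ _ (\sum_(k < n) theta * C * q ^+ k)).
    apply: ler_sum => k _; rewrite /= /step addrK seminormZ ?gtr0_norm//; last first.
      exact/Sr/Sx.
    by rewrite -mulrA ler_pM2l.
  by apply: geometric_partial_sum_le => //; rewrite mulr_ge0 ?seminorm_ge0 ?ltW.
exists l => // v Sv; apply/eqP; rewrite -subr_eq0; apply/eqP.
apply: (@eq0_le_cvg0 _ (fun n => K * seminorm v * seminorm (x n - l) +
    seminorm v * (C * q ^+ n))).
  have -> : 0 = K * seminorm v * 0 + seminorm v * 0 by rewrite !mulr0 addr0.
  by apply: cvgD; apply: cvgMl_tmp.
move=> n; have [STx TxP] := TP _ (Sx n).
have -> : b l v - F v = - b (x n - l) v - ip (f - T (x n)) v.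
  rewrite (linear_onB (bl v Sv))// (linear_onB (ipl v Sv))// -TxP// -fP//; lra.
apply: le_trans (ler_normB _ _) _; rewrite normrN lerD//.
  have Sxl : S (x n - l) by exact: subspaceB.
  apply: le_trans (bM _ _ Sxl Sv) _; rewrite mulrAC !ler_wpM2r ?seminorm_ge0//.
  by have := ler_norm M; rewrite /K; lra.
have Srx := Sr _ (Sx n).
apply: le_trans (ip_CauchySchwarz Srx Sv) _.
by rewrite mulrC ler_wpM2l ?seminorm_ge0.
Qed.

End LaxMilgram.

(** * Sesquilinear forms on spaces of complex functions *)

Section Modulus.
Context {R : realType}.
Implicit Types z w : R[i].

Lemma complex_eq z w :
  complex.Re z = complex.Re w -> complex.Im z = complex.Im w -> z = w.
Proof. by case: z => a b; case: w => c d /= -> ->. Qed.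

Lemma conjcD_real z w (a : R) : (z + a%:C * w)^* = z^* + a%:C * w^*.
Proof. by case: z => p q; case: w => s t; apply: complex_eq => /=; ring. Qed.

Lemma cabsN1 : cabs (-1 : R[i]) = 1.
Proof. by rewrite /= oppr0 expr0n sqrrN expr1n addr0 sqrtr1. Qed.

Lemma cabs_sqr z : cabs z ^+ 2 = complex.Re z ^+ 2 + complex.Im z ^+ 2.
Proof. by case: z => a b /=; rewrite sqr_sqrtr// addr_ge0 ?sqr_ge0. Qed.

Lemma cabs_ge0 z : 0 <= cabs z.
Proof. by case: z => a b; exact: sqrtr_ge0. Qed.

Lemma cabs_eq0 z : (cabs z == 0) = (z == 0).
Proof.
apply/eqP/eqP => [/ComplexField.Normc.eq0_normc//|->].
exact: ComplexField.Normc.normc0.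
Qed.

Lemma cabsM z w : cabs (z * w) = cabs z * cabs w.
Proof. exact: ComplexField.Normc.normcM. Qed.

Lemma cabsD z w : cabs (z + w) <= cabs z + cabs w.
Proof. exact: le_normcD. Qed.

Lemma cabsJ z : cabs z^* = cabs z.
Proof. by case: z => a b /=; rewrite sqrrN. Qed.

Lemma normr_Re_le z : `|complex.Re z| <= cabs z.
Proof.
rewrite -ler_sqr ?nnegrE ?cabs_ge0// cabs_sqr real_normK ?num_real//.
by rewrite lerDl sqr_ge0.
Qed.

Lemma mulcJ z : z * z^* = (cabs z ^+ 2)%:C.
Proof. by rewrite cabs_sqr; case: z => a b; apply: complex_eq => /=; ring. Qed.

End Modulus.

(** * Hermitian forms and the passage from real to complex Lax-Milgram *)

Section Sesquilinear.
Context {R : realType} {T : Type}.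
Implicit Types (S : set (T -> R[i])) (u v w : T -> R[i]) (a c : R[i])
  (h : (T -> R[i]) -> (T -> R[i]) -> R[i]).

Definition complex_subspace S :=
  S (fun=> 0) /\
  forall a u v, S u -> S v -> S (fun x => a * u x + v x).

Definition sesquilinear_on S h :=
  (forall a u v w, S u -> S v -> S w ->
     h (fun x => a * u x + v x) w = a * h u w + h v w) /\
  (forall a u v w, S u -> S v -> S w ->
     h w (fun x => a * u x + v x) = a^* * h w u + h w v).

Definition antilinear_on S (F : (T -> R[i]) -> R[i]) :=
  forall a u v, S u -> S v ->
    F (fun x => a * u x + v x) = a^* * F u + F v.

Definition hermitian_nonneg_on S h :=
  [/\ sesquilinear_on S h, forall u v, S u -> S v -> h v u = (h u v)^*
    & forall u, S u -> 0 <= complex.Re (h u u)].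

Definition hnorm h u :=
  Num.sqrt (complex.Re (h u u)).

(* [Rcomplex R] carries the R-module structure of the complex field. *)
Local Notation RV := (T -> Rcomplex R).

Lemma scale_addE (a : R) (u v : RV) :
  a *: u + v = (fun x => a%:C * (u x : R[i]) + v x) :> RV.
Proof.
apply/funext => x; rewrite !fctE.
by case: (u x) => p q; case: (v x) => s t; simpc.
Qed.

Section Subspace.
Variable S : set (T -> R[i]).
Hypothesis subS : complex_subspace S.

Lemma complex_subspaceB u v : S u -> S v -> S (fun x => u x - v x).
Proof.
move=> Su Sv; have -> : (fun x => u x - v x) = (fun x => -1 * v x + u x).
  by apply/funext => x; rewrite mulN1r addrC.
by case: subS => _; apply.
Qed.

Lemma complex_subspaceZ a u : S u -> S (fun x => a * u x).
Proof.
move=> Su; have -> : (fun x => a * u x) = (fun x => a * u x + 0).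
  by apply/funext => x; rewrite addr0.
by case: subS => S0 SD; apply: SD.
Qed.

Lemma antilinear0 F : antilinear_on S F -> F (fun=> 0) = 0.
Proof.
have [S0 _] := subS => Fl; have := Fl (-1) _ _ S0 S0.
rewrite (_ : (fun x : T => _) = (fun=> 0)).
  by rewrite rmorphN1 mulN1r addNr.
by apply/funext => x; rewrite mulr0 addr0.
Qed.

Lemma antilinearZ F a u : antilinear_on S F -> S u ->
  F (fun x => a * u x) = a^* * F u.
Proof.
have [S0 _] := subS => Fl Su.
rewrite -[RHS]addr0 -[X in _ + X](antilinear0 Fl) -Fl//; congr F.
by apply/funext => x; rewrite addr0.
Qed.

Lemma antilinearB F u v : antilinear_on S F -> S u -> S v ->
  F (fun x => u x - v x) = F u - F v.
Proof.
move=> Fl Su Sv; have := Fl (-1) v u Sv Su; rewrite rmorphN1 mulN1r addrC => <-.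
by congr F; apply/funext => x; rewrite mulN1r addrC.
Qed.

Lemma sesquilinear_antilinear h w : sesquilinear_on S h -> S w ->
  antilinear_on S (h w).
Proof. by move=> [_ hr] Sw a u v Su Sv; exact: hr. Qed.

(** Conjugating makes the first argument antilinear too, so the rules for zero, scaling and
    differences are proved once, for antilinear functionals, and transported by [conjc]. *)
Lemma sesquilinear_antilinearJ h w : sesquilinear_on S h -> S w ->
  antilinear_on S (fun u => (h u w)^*).
Proof.
by move=> [hl _] Sw a u v Su Sv; rewrite hl// rmorphD rmorphM.
Qed.

Lemma sesquilinearZl h a u w : sesquilinear_on S h -> S u -> S w ->
  h (fun x => a * u x) w = a * h u w.
Proof.
move=> hs Su Sw; have := antilinearZ a (sesquilinear_antilinearJ hs Sw) Su.
by move=> /(congr1 (@conjc R)); rewrite conjcK rmorphM /= !conjcK.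
Qed.

Lemma sesquilinearBl h u v w : sesquilinear_on S h -> S u -> S v -> S w ->
  h (fun x => u x - v x) w = h u w - h v w.
Proof.
move=> hs Su Sv Sw.
have := antilinearB (sesquilinear_antilinearJ hs Sw) Su Sv.
by move=> /(congr1 (@conjc R)); rewrite conjcK rmorphB /= !conjcK.
Qed.

Lemma sesquilinear0l h w : sesquilinear_on S h -> S w -> h (fun=> 0) w = 0.
Proof.
move=> hs Sw; have := antilinear0 (sesquilinear_antilinearJ hs Sw).
by move=> /(congr1 (@conjc R)); rewrite conjcK conjc0.
Qed.

Lemma sesquilinear_bilinear h c : sesquilinear_on S h ->
  bilinear_on (S : set RV) (fun u v => complex.Re (c * h u v)).
Proof.
move=> [hl hr]; split => w Sw a u v Su Sv; rewrite scale_addE.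
  rewrite hl// mulrDr mulrCA.
  by case: (c * h u w) (c * h v w) => [? ?] [? ?]; simpc.
rewrite hr// mulrDr mulrCA.
by case: (c * h w u) (c * h w v) => [? ?] [? ?]; simpc.
Qed.

Variable h : (T -> R[i]) -> (T -> R[i]) -> R[i].
Hypothesis hP : hermitian_nonneg_on S h.

Lemma hnorm_ge0 u : 0 <= hnorm h u.
Proof. exact: sqrtr_ge0. Qed.

Lemma hnorm_sqr u : S u -> hnorm h u ^+ 2 = complex.Re (h u u).
Proof. by case: hP => _ _ h0 Su; rewrite sqr_sqrtr ?h0. Qed.

Lemma hermitian_real u : S u -> h u u = (hnorm h u ^+ 2)%:C.
Proof.
move=> Su; rewrite hnorm_sqr//; case: hP => _ hC _; have := hC _ _ Su Su.
by case: (h u u) => a b /= [b0]; congr (_ +i* _); lra.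
Qed.

Lemma hermitian_bilinear : [/\ bilinear_on (S : set RV) (fun u v => complex.Re (h u v)),
  forall u v, S u -> S v -> complex.Re (h u v) = complex.Re (h v u) &
  forall u, S u -> 0 <= complex.Re (h u u)].
Proof.
case: hP => hs hC h0; split => // [|u v Su Sv].
  rewrite (_ : (fun u v => _) = fun u v => complex.Re (1 * h u v)).
    exact: sesquilinear_bilinear.
  by apply/funext => u; apply/funext => v; rewrite mul1r.
by rewrite (hC u v)//; case: (h u v).
Qed.

Lemma real_subspace : S (0 : RV) /\
  forall (a : R) (u v : RV), S u -> S v -> S (a *: u + v).
Proof.
case: subS => S0 SD; split=> // a u v Su Sv.
by rewrite scale_addE; exact: SD.
Qed.

Lemma hnormZ a u : S u -> hnorm h (fun x => a * u x) = cabs a * hnorm h u.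
Proof.
move=> Su; case: (hP) => hs hC h0; have Sau := complex_subspaceZ a Su.
apply/eqP; rewrite -(@eqrXn2 _ 2) ?mulr_ge0 ?cabs_ge0 ?hnorm_ge0// exprMn.
rewrite hnorm_sqr// sesquilinearZl//.
rewrite (antilinearZ _ (sesquilinear_antilinear hs Su))//.
by rewrite mulrA mulcJ hermitian_real// -rmorphM.
Qed.

(** Multiplying [u] by the conjugate of [h u v] turns the pairing into its squared modulus, a real
    number. The real inequality then loses nothing, and one factor [cabs (h u v)] cancels. *)
Lemma hermitian_CauchySchwarz u v : S u -> S v ->
  cabs (h u v) <= hnorm h u * hnorm h v.
Proof.
move=> Su Sv; have [S0 SD] := real_subspace.
have [hb hC h0] := hermitian_bilinear.
have [->|huv0] := eqVneq (h u v) 0.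
  by rewrite ComplexField.Normc.normc0 mulr_ge0 ?hnorm_ge0.
have huv_gt0 : 0 < cabs (h u v) by rewrite lt_def cabs_eq0 huv0 cabs_ge0.
have Su' := complex_subspaceZ (h u v)^* Su.
have : `|complex.Re (h (fun x => (h u v)^* * u x) v)| <=
    hnorm h (fun x => (h u v)^* * u x) * hnorm h v.
  exact: (@ip_CauchySchwarz R RV S _ SD hb hC h0).
rewrite hnormZ// cabsJ.
case: (hP) => hs _ _; rewrite sesquilinearZl// mulrC mulcJ /=.
rewrite ger0_norm ?sqr_ge0// expr2 -mulrA.
by rewrite ler_pM2l.
Qed.

Lemma hermitian_eq0l u v : S u -> S v -> hnorm h u = 0 -> h u v = 0.
Proof.
move=> Su Sv u0; apply/eqP; rewrite -cabs_eq0 eq_le cabs_ge0 andbT.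
by rewrite (le_trans (hermitian_CauchySchwarz Su Sv))// u0 mul0r.
Qed.

(* [c] rotates the form into the right half-plane. *)
Lemma complex_lax_milgram A F c alpha M N :
  (forall x : nat -> T -> R[i], (forall n, S (x n)) ->
    (exists K, forall n,
       \sum_(k < n) hnorm h (fun y => x k.+1 y - x k y) <= K) ->
    exists2 l, S l & (fun n => hnorm h (fun y => x n y - l y)) @ \oo --> 0) ->
  sesquilinear_on S A -> antilinear_on S F -> c != 0 -> 0 < alpha ->
  (forall u, S u -> alpha * hnorm h u ^+ 2 <= complex.Re (c * A u u)) ->
  (forall u v, S u -> S v -> cabs (A u v) <= M * hnorm h u * hnorm h v) ->
  (forall v, S v -> cabs (F v) <= N * hnorm h v) ->
  exists2 u, S u & forall v, S v -> A u v = F v.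
Proof.
move=> S_complete As Fl c0 a0 coercive AM FN; have [S0 SD] := real_subspace.
have [hb hC h0] := hermitian_bilinear.
have cF : linear_on (S : set RV) (fun v => complex.Re (c * F v)).
  move=> a u v Su Sv; rewrite scale_addE Fl// mulrDr mulrCA.
  by case: (c * F u) (c * F v) => [? ?] [? ?]; simpc.
have cle z k : cabs z <= k -> `|complex.Re (c * z)| <= cabs c * k.
  move=> zk; apply: le_trans (normr_Re_le _) _.
  by rewrite cabsM ler_wpM2l ?cabs_ge0.
have [|||u Su uP] := @lax_milgram R RV S _ S0 SD hb hC h0 S_complete _ _ alpha
    (cabs c * M) (cabs c * N) (sesquilinear_bilinear c As) cF a0.
- by move=> u; exact: coercive.
- by move=> u v Su Sv; rewrite -!mulrA; apply: cle; rewrite mulrA; exact: AM.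
- by move=> v Sv; rewrite -mulrA; apply: cle; exact: FN.
exists u => // v Sv; apply/eqP; rewrite -subr_eq0; apply/eqP/(mulfI c0).
(* The real problem equates real parts only; testing with ['i * v] supplies the imaginary parts. *)
have := uP _ (complex_subspaceZ 'i Sv); have := uP _ Sv.
rewrite (antilinearZ _ (sesquilinear_antilinear As Su))// (antilinearZ _ Fl)//.
rewrite mulr0 mulrBr !(mulrCA c).
case: (c * A u v) (c * F v) => [p q] [s t]; simpc => /= -> E.
have -> : q = t by lra.
by rewrite !subrr.
Qed.

End Subspace.
End Sesquilinear.

(** * Completeness of L^2 *)

(** The square of the variation is bounded because that is the quantity an integrable majorant
    controls pointwise in L^2. The bound on [x n - l], uniform in [n], later serves as
    domination. *)
Lemma cvg_bounded_variation (R : realType) (x : nat -> R) (K : R) :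
  (forall n, (\sum_(k < n) `|x k.+1 - x k|) ^+ 2 <= K) ->
  exists l, x @ \oo --> l /\ forall n, (x n - l) ^+ 2 <= K.
Proof.
set G := fun n => \sum_(k < n) `|x k.+1 - x k| => GK.
have G0 n : 0 <= G n by apply: sumr_ge0.
have xG n m : (n <= m)%N -> `|x n - x m| <= G m.
  move=> nm; rewrite distrC -(telescope_sumr _ nm).
  apply: le_trans (ler_norm_sum _ _ _) _.
  have -> : G m = \sum_(0 <= k < m) `|x k.+1 - x k| by rewrite big_mkord.
  by rewrite [leRHS](big_cat_nat (n := n))//= lerDr sumr_ge0.
have cx : cvgn x.
  have /normed_cvg : cvgn [normed series (fun k => x k.+1 - x k : R^o)].
    apply: nondecreasing_is_cvgn.
      by apply: nondecreasing_series => k _ _; exact: normr_ge0.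
    exists (1 + K) => _ [n _ <-].
    rewrite -[leLHS]/(series (fun k => `|x k.+1 - x k|) n) seriesEord /= -/(G n).
    have := GK n; have := sqr_ge0 (G n - 1); have := sqr_ge0 (G n).
    rewrite sqrrB !expr2; lra.
  move=> /cvg_ex[l /= xl]; apply/cvg_ex; exists (l + x 0); apply/cvgrPdist_lt => e e0.
  move/cvgrPdist_lt/(_ e e0): xl; apply: filterS => n.
  rewrite seriesEnat /= telescope_sumr// => /le_lt_trans; apply.
  by rewrite le_eqVlt; apply/orP; left; apply/eqP; congr (`| _ |); ring.
exists (lim (x @ \oo)); split => // n.
have c2 : (fun m => (x n - x m) ^+ 2) @ \oo --> (x n - lim (x @ \oo)) ^+ 2.
  rewrite expr2; under eq_fun do rewrite expr2.
  by apply: cvgM; apply: cvgB => //; exact: cvg_cst.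
rewrite -(cvg_lim _ c2)//; apply: limr_le; first exact: cvgP c2.
exists n => // m /= nm; apply: le_trans (GK m).
rewrite -[leLHS]real_normK ?num_real// ler_sqr ?nnegrE ?G0//.
exact: xG.
Qed.

(** * Real-valued square-integrable functions and Riesz-Fischer *)

Section SquareIntegrable.
Context d (T : measurableType d) (R : realType).
Variables (mu : {measure set T -> \bar R}) (D : set T).
Hypothesis mD : measurable D.
Implicit Types (f g : T -> R) (a : R).

Definition square_integrable f := measurable_fun D f /\
  (\int[mu]_(x in D) (f x ^+ 2)%:E < +oo)%E.

Definition pairing f g := Rintegral mu D (fun x => f x * g x).

Lemma square_integrable_sqr f : square_integrable f ->
  mu.-integrable D (fun x => (f x ^+ 2)%:E).
Proof.
move=> [mf foo]; apply/integrableP; split.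
  by apply/measurable_EFinP; exact: measurable_funX.
by under eq_integral do rewrite gee0_abs ?lee_fin ?sqr_ge0//.
Qed.

Lemma le_square_integrable f (g : T -> \bar R) : measurable_fun D f ->
  mu.-integrable D g -> (forall x, D x -> (f x ^+ 2)%:E <= g x)%E ->
  square_integrable f.
Proof.
move=> mf ig fg; split=> //.
have /integrableP[_] : mu.-integrable D (fun x => (f x ^+ 2)%:E).
  apply: le_integrable ig => //; first by apply/measurable_EFinP/measurable_funX.
  move=> x Dx; rewrite gee0_abs ?lee_fin ?sqr_ge0//.
  by apply: le_trans (fg _ Dx) _; exact: lee_abs.
by under eq_integral do rewrite gee0_abs ?lee_fin ?sqr_ge0//.
Qed.

Lemma integrable_mul f g : square_integrable f -> square_integrable g ->
  mu.-integrable D (EFin \o (fun x => f x * g x)).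
Proof.
move=> sf sg; have := integrableD mD (square_integrable_sqr sf)
  (square_integrable_sqr sg).
apply: le_integrable => //.
  by apply/measurable_EFinP/measurable_funM; [case: sf|case: sg].
move=> x Dx; rewrite /= lee_fin normrM [leRHS]ger0_norm ?addr_ge0 ?sqr_ge0//.
rewrite -(real_normK (num_real (f x))) -(real_normK (num_real (g x))).
have := sqr_ge0 (`|f x| - `|g x|).
have := mulr_ge0 (normr_ge0 (f x)) (normr_ge0 (g x)).
by rewrite sqrrB; lra.
Qed.

Lemma square_integrable0 : square_integrable (fun=> 0).
Proof.
split; first exact: measurable_cst.
by under eq_integral do rewrite expr0n; rewrite integral0.
Qed.

Lemma square_integrableD a f g : square_integrable f -> square_integrable g ->
  square_integrable (fun x => a * f x + g x).
Proof.
move=> sf sg; have [mf _] := sf; have [mg _] := sg.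
apply: (@le_square_integrable _
    (fun x => (2 * a ^+ 2)%:E * (f x ^+ 2)%:E + 2%:E * (g x ^+ 2)%:E)%E).
- apply: measurable_funD => //; apply: measurable_funM => //.
- apply: integrableD => //; apply: integrableZl => //;
  exact: square_integrable_sqr.
- move=> x Dx; rewrite -!EFinM -EFinD lee_fin.
  have := sqr_ge0 (a * f x - g x).
  by rewrite sqrrB sqrrD !exprMn; lra.
Qed.

Lemma pairingC f g : pairing f g = pairing g f.
Proof. by congr Rintegral; apply/funext => x; rewrite mulrC. Qed.

Lemma pairing_linear a f g h : square_integrable f -> square_integrable g ->
  square_integrable h ->
  pairing (fun x => a * f x + g x) h = a * pairing f h + pairing g h.
Proof.
move=> sf sg sh; have fh := integrable_mul sf sh; have gh := integrable_mul sg sh.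
rewrite /pairing -RintegralZl// -RintegralD//.
  by congr Rintegral; apply/funext => x; ring.
exact: (integrableZl mD a fh).
Qed.

Lemma pairing_ge0 f : 0 <= pairing f f.
Proof. by apply: Rintegral_ge0 => x _; rewrite -expr2 sqr_ge0. Qed.

Local Notation RV := (T -> R^o).

Lemma pairing_bilinear : bilinear_on (square_integrable : set RV) pairing.
Proof.
split => w sw a u v su sv; first exact: pairing_linear.
by rewrite !(pairingC w); exact: pairing_linear.
Qed.

Definition l2norm f := Num.sqrt (Rintegral mu D (fun x => f x ^+ 2)).

Lemma l2normE f : l2norm f = seminorm (pairing : RV -> RV -> R) f.
Proof.
by congr (Num.sqrt (Rintegral _ _ _)); apply/funext => x; rewrite expr2.
Qed.

Lemma l2normD f g : square_integrable f -> square_integrable g ->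
  l2norm (fun x => f x + g x) <= l2norm f + l2norm g.
Proof.
move=> sf sg; rewrite !l2normE.
apply: (@seminormD R RV square_integrable pairing) => //.
- by move=> a u v; exact: square_integrableD.
- exact: pairing_bilinear.
- by move=> u v _ _; exact: pairingC.
- by move=> u _; exact: pairing_ge0.
Qed.

Lemma l2norm_sqrE f : square_integrable f ->
  (\int[mu]_(x in D) (f x ^+ 2)%:E = (l2norm f ^+ 2)%:E)%E.
Proof.
move=> sf; rewrite /l2norm sqr_sqrtr; last first.
  by apply: Rintegral_ge0 => x _; exact: sqr_ge0.
rewrite /Rintegral fineK//.
exact: integrable_fin_num (square_integrable_sqr sf).
Qed.

Lemma square_integrable_norm f : square_integrable f ->
  square_integrable (fun x => `|f x|).
Proof.
move=> [mf foo]; split; first exact: measurableT_comp.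
by under eq_integral do rewrite real_normK ?num_real//.
Qed.

Lemma l2norm_norm f : l2norm (fun x => `|f x|) = l2norm f.
Proof.
congr (Num.sqrt (Rintegral _ _ _)); apply/funext => x.
by rewrite real_normK ?num_real.
Qed.

(* Riesz-Fischer.  The partial sums of [`|x k.+1 - x k|] are bounded in L^2, so
   by monotone convergence the square of their limit is an integrable function
   dominating [(x n - l) ^+ 2]. *)
Lemma square_integrable_complete (x : nat -> T -> R) :
  (forall n, square_integrable (x n)) ->
  (exists M, forall n, \sum_(k < n) l2norm (fun y => x k.+1 y - x k y) <= M) ->
  exists2 l, square_integrable l &
    (fun n => l2norm (fun y => x n y - l y)) @ \oo --> 0.
Proof.
move=> sx [M xM].
have sB f g : square_integrable f -> square_integrable g ->
    square_integrable (fun y => f y - g y).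
  move=> sf sg; rewrite (_ : (fun y => _) = fun y => -1 * g y + f y).
    exact: square_integrableD.
  by apply/funext => y; rewrite mulN1r addrC.
have sD f g : square_integrable f -> square_integrable g ->
    square_integrable (fun y => f y + g y).
  move=> sf sg; rewrite (_ : (fun y => _) = fun y => 1 * f y + g y).
    exact: square_integrableD.
  by apply/funext => y; rewrite mul1r.
pose G n y := \sum_(k < n) `|x k.+1 y - x k y|.
have GS n : G n.+1 = (fun y => G n y + `|x n.+1 y - x n y|).
  by apply/funext => y; rewrite /G big_ord_recr.
have G0E : G 0%N = (fun=> 0) by apply/funext => y; rewrite /G big_ord0.
have sG n : square_integrable (G n).
  elim: n => [|n IH]; first by rewrite G0E; exact: square_integrable0.
  by rewrite GS; apply: sD => //; exact/square_integrable_norm/sB.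
have G_le n : l2norm (G n) <= M.
  apply: le_trans (xM n); elim: n => [|n IH].
    rewrite G0E big_ord0 /l2norm.
    rewrite (_ : Rintegral _ _ _ = 0) ?sqrtr0//.
    by rewrite /Rintegral; under eq_integral do rewrite expr0n; rewrite integral0.
  rewrite GS big_ord_recr /=.
  apply: le_trans (l2normD (sG n) (square_integrable_norm (sB _ _ (sx _) (sx _)))) _.
  by rewrite l2norm_norm lerD2r.
have G_ge0 n y : 0 <= G n y by apply: sumr_ge0.
have mG2 n : measurable_fun D (fun y => (G n y ^+ 2)%:E).
  by apply/measurable_EFinP/measurable_funX; case: (sG n).
have ndG y : {homo (fun n => (G n y ^+ 2)%:E) : n m / (n <= m)%N >-> (n <= m)%E}.
  apply/nondecreasing_seqP => n; rewrite lee_fin ler_sqr ?nnegrE// GS.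
  by rewrite lerDl.
pose g y := limn (fun n => (G n y ^+ 2)%:E).
have G_g n y : ((G n y ^+ 2)%:E <= g y)%E.
  rewrite /g (cvg_lim _ (ereal_nondecreasing_cvgn (ndG y)))//.
  by apply: ereal_sup_ubound; exists n.
have mg : measurable_fun D g.
  apply: (emeasurable_fun_cvg (fun n y => (G n y ^+ 2)%:E)) => // y _.
  exact: ereal_nondecreasing_is_cvgn.
have ig : mu.-integrable D g.
  apply/integrableP; split=> //.
  have -> : (\int[mu]_(y in D) `|g y| = \int[mu]_(y in D) g y)%E.
    apply: eq_integral => y _; rewrite gee0_abs//.
    by apply: le_trans (G_g 0%N y); rewrite lee_fin sqr_ge0.
  rewrite /g monotone_convergence//; last first.
    by move=> n y _; rewrite lee_fin sqr_ge0.
  apply: (@le_lt_trans _ _ (M ^+ 2)%:E); last exact: ltry.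
  apply: lime_le.
    apply: ereal_nondecreasing_is_cvgn => n m nm.
    apply: ge0_le_integral => //; try by move=> y _; rewrite lee_fin sqr_ge0.
    by move=> y _; exact: ndG.
  apply: nearW => n; rewrite l2norm_sqrE// lee_fin.
  rewrite ler_sqr ?nnegrE ?sqrtr_ge0//.
  by apply: le_trans (G_le 0%N); rewrite sqrtr_ge0.
(* The upper limit gives a function that is defined and measurable everywhere; it is the genuine
   limit wherever [g] is finite, hence almost everywhere. *)
pose l y := fine (limn_esup (fun n => (x n y)%:E)).
have ml : measurable_fun D l.
  apply: (measurableT_comp (fine_measurable _)) => //.
  apply: measurable_fun_limn_esup => n.
  by apply/measurable_EFinP; case: (sx n).
have lP y : g y \is a fin_num ->
    (fun n => x n y) @ \oo --> l y /\ forall n, (((x n y - l y) ^+ 2)%:E <= g y)%E.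
  move=> gy; have [n|z [xz zg]] := @cvg_bounded_variation R (x^~ y) (fine (g y)).
    by rewrite -lee_fin fineK//; exact: G_g.
  have xzE : (fun n => (x n y)%:E) @ \oo --> z%:E by apply: cvg_EFin => //; exact: nearW.
  have -> : l y = z by rewrite /l (cvg_limn_einf_sup xzE).2.
  by split => // n; rewrite -[leRHS]fineK// lee_fin.
have gfin := integrable_ae mD ig.
(* [g] controls the distance of [l] to the sequence rather than [l] itself, so square-integrability
   is shown for [x 0 - l] and then carried over to [l]. *)
have sl : square_integrable (fun y => x 0%N y - l y).
  split; first by apply: measurable_funB => //; case: (sx 0%N).
  apply: (@le_lt_trans _ _ (\int[mu]_(y in D) `|g y|)%E); last first.
    by case/integrableP: ig.
  apply: ae_ge0_le_integral => //.
  - by move=> y _; rewrite lee_fin sqr_ge0.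
  - apply/measurable_EFinP/measurable_funX/measurable_funB => //.
    by case: (sx 0%N).
  - exact: measurableT_comp.
  apply: filterS gfin => y gy Dy; have [_ /(_ 0%N) le_g] := lP _ (gy Dy).
  by apply: le_trans le_g _; exact: lee_abs.
have {}sl : square_integrable l.
  rewrite (_ : l = fun y => x 0%N y - (x 0%N y - l y)); first exact: sB.
  by apply/funext => y; rewrite subKr.
exists l => //.
have mxl n : measurable_fun D (fun y => ((x n y - l y) ^+ 2)%:E).
  by apply/measurable_EFinP/measurable_funX; case: (sB _ _ (sx n) sl).
have cxl : {ae mu, forall y, D y ->
    (fun n => ((x n y - l y) ^+ 2)%:E) @ \oo --> cst 0%E y}.
  apply: filterS gfin => y gy Dy; have [xl _] := lP _ (gy Dy).
  have lc : (fun n : nat => l y) @ \oo --> l y by exact: cvg_cst.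
  have d0 : (fun n => x n y - l y) @ \oo --> (0 : R).
    by rewrite -(subrr (l y)); exact: cvgB xl lc.
  have sq0 : (fun n => (x n y - l y) ^+ 2) @ \oo --> (0 : R).
    under eq_fun do rewrite expr2.
    by rewrite -(mulr0 0); exact: (cvgM d0 d0).
  by apply: cvg_EFin; [exact: nearW|exact: sq0].
have xl_g : {ae mu, forall y n, D y -> (`|((x n y - l y) ^+ 2)%:E| <= g y)%E}.
  apply: filterS gfin => y gy n Dy; have [_] := lP _ (gy Dy).
  by rewrite gee0_abs ?lee_fin ?sqr_ge0.
have [_ _] := dominated_convergence mD mxl (measurable_cst _) cxl ig xl_g.
rewrite integral0 /= => cvg0; rewrite -sqrtr0.
exact: (cvg_comp _ _ (fine_cvg cvg0) (@sqrt_continuous R 0)).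
Qed.

End SquareIntegrable.

(** * Complex-valued L^2, by real and imaginary parts *)

Section ComplexL2.
Context d (T : measurableType d) (R : realType).
Variables (mu : {measure set T -> \bar R}) (D : set T).
Hypothesis mD : measurable D.
Implicit Types (f g : T -> R[i]) (a : R[i]).

Local Notation L2 := (isL2 mu D).
Local Notation re f := (fun x => complex.Re (f x)).
Local Notation im f := (fun x => complex.Im (f x)).
Local Notation sq := (square_integrable mu D).
Local Notation "<< f , g >>" := (pairing mu D f g).

Lemma isL2P f : L2 f <-> sq (re f) /\ sq (im f).
Proof.
have E : (fun x => (cabs (f x) ^+ 2)%:E) =
    (fun x => (complex.Re (f x) ^+ 2)%:E + (complex.Im (f x) ^+ 2)%:E)%E.
  by apply/funext => x; rewrite cabs_sqr EFinD.
split=> [[mr mi foo]|[sr si]].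
  have ig : mu.-integrable D (fun x => (cabs (f x) ^+ 2)%:E).
    apply/integrableP; split.
      rewrite E; apply: emeasurable_funD;
      by apply/measurable_EFinP/measurable_funX.
    by under eq_integral do rewrite gee0_abs ?lee_fin ?sqr_ge0//.
  split; apply: (le_square_integrable mD _ ig) => // x Dx;
  by rewrite lee_fin cabs_sqr ?lerDl ?lerDr sqr_ge0.
split; [by case: sr|by case: si|].
have := integrableD mD (square_integrable_sqr sr) (square_integrable_sqr si).
rewrite -E => /integrableP[_].
by under eq_integral do rewrite gee0_abs ?lee_fin ?sqr_ge0//.
Qed.

Lemma isL2_subspace : complex_subspace L2.
Proof.
split; first by apply/isL2P; split; exact: square_integrable0.
move=> a u v /isL2P[ru iu] /isL2P[rv iv]; apply/isL2P; split.
- rewrite (_ : (fun x => _) = fun x => complex.Re a * complex.Re (u x) +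
      (- complex.Im a * complex.Im (u x) + complex.Re (v x))).
    by do 2 apply: square_integrableD => //.
  by apply/funext => x; case: a (u x) (v x) => ? ? [? ?] [? ?] /=; ring.
- rewrite (_ : (fun x => _) = fun x => complex.Re a * complex.Im (u x) +
      (complex.Im a * complex.Re (u x) + complex.Im (v x))).
    by do 2 apply: square_integrableD => //.
  by apply/funext => x; case: a (u x) (v x) => ? ? [? ?] [? ?] /=; ring.
Qed.

Lemma L2dotE f g : L2 f -> L2 g -> L2dot mu D f g =
  (<< re f, re g >> + << im f, im g >>) +i* (<< im f, re g >> - << re f, im g >>).
Proof.
move=> /isL2P[rf jf] /isL2P[rg jg]; rewrite /L2dot /cintegral /pairing.
congr (_ +i* _).
- rewrite -RintegralD//; try exact: integrable_mul.
  congr Rintegral; apply/funext => x.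
  by case: (f x) (g x) => ? ? [? ?] /=; ring.
- rewrite -RintegralB//; try exact: integrable_mul.
  congr Rintegral; apply/funext => x.
  by case: (f x) (g x) => ? ? [? ?] /=; ring.
Qed.

Lemma hnorm_L2dot f : hnorm (L2dot mu D) f = L2norm mu D f.
Proof.
congr (Num.sqrt (Rintegral _ _ _)); apply/funext => x.
by rewrite mulcJ.
Qed.

Lemma L2dot_linearl a f g h : L2 f -> L2 g -> L2 h ->
  L2dot mu D (fun x => a * f x + g x) h = a * L2dot mu D f h + L2dot mu D g h.
Proof.
move=> Lf Lg Lh; have [_ SD] := isL2_subspace.
rewrite !L2dotE//; last exact: SD.
move: Lf Lg Lh => /isL2P[rf jf] /isL2P[rg jg] /isL2P[rh jh].
rewrite (_ : re (fun x => a * f x + g x) = fun x => complex.Re a * complex.Re (f x) +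
      (- complex.Im a * complex.Im (f x) + complex.Re (g x))); last first.
  by apply/funext => x; case: a (f x) (g x) => ? ? [? ?] [? ?] /=; ring.
rewrite (_ : im (fun x => a * f x + g x) = fun x => complex.Re a * complex.Im (f x) +
      (complex.Im a * complex.Re (f x) + complex.Im (g x))); last first.
  by apply/funext => x; case: a (f x) (g x) => ? ? [? ?] [? ?] /=; ring.
have sD b u v := @square_integrableD _ _ _ mu D mD b u v.
rewrite !(pairing_linear mD) //; try by apply: sD.
by case: a => p q; apply: complex_eq => /=; ring.
Qed.

Lemma L2dotC f g : L2 f -> L2 g -> L2dot mu D g f = (L2dot mu D f g)^*.
Proof.
move=> Lf Lg; rewrite !L2dotE// /= ![pairing mu D (fun x => _ (g x)) _]pairingC.
by rewrite opprB.
Qed.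

Lemma L2dot_hermitian : hermitian_nonneg_on L2 (L2dot mu D).
Proof.
have [_ SD] := isL2_subspace.
split; [split|exact: L2dotC|].
- by move=> a u v w; exact: L2dot_linearl.
- move=> a u v w Lu Lv Lw.
  rewrite (L2dotC (SD a _ _ Lu Lv) Lw) L2dot_linearl// (L2dotC Lu Lw).
  by rewrite (L2dotC Lv Lw) rmorphD rmorphM.
- move=> u Lu; apply: Rintegral_ge0 => x _.
  by rewrite mulcJ /= sqr_ge0.
Qed.

Lemma L2norm_sqrE f : L2 f ->
  (\int[mu]_(x in D) (cabs (f x) ^+ 2)%:E = (L2norm mu D f ^+ 2)%:E)%E.
Proof.
move=> [mr mi foo]; rewrite /L2norm sqr_sqrtr; last first.
  by apply: Rintegral_ge0 => x _; exact: sqr_ge0.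
rewrite /Rintegral fineK// ge0_fin_numE//.
by apply: integral_ge0 => x _; rewrite lee_fin sqr_ge0.
Qed.

Lemma measurable_cabs_sqr f : L2 f -> measurable_fun D (fun x => cabs (f x) ^+ 2).
Proof.
move=> [mr mi _]; under eq_fun do rewrite cabs_sqr.
by apply: measurable_funD; exact: measurable_funX.
Qed.

Lemma L2norm_eq0 f : L2 f ->
  L2norm mu D f = 0 <-> {ae mu, forall x, D x -> f x = 0}.
Proof.
move=> Lf; have mf := measurable_cabs_sqr Lf.
have : (\int[mu]_(x in D) `|(cabs (f x) ^+ 2)%:E| = 0)%E <->
    ae_eq mu D (fun x => (cabs (f x) ^+ 2)%:E) (cst 0%E).
  by apply: ae_eq_integral_abs => //; exact/measurable_EFinP.
under eq_integral do rewrite gee0_abs ?lee_fin ?sqr_ge0//.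
rewrite L2norm_sqrE// => H; split=> [f0|ae0].
  have /H.1 : (L2norm mu D f ^+ 2)%:E = 0%E by rewrite f0 expr0n.
  apply: filterS => x /[apply] -[/eqP].
  by rewrite sqrf_eq0 cabs_eq0 => /eqP.
have /H.2 : ae_eq mu D (fun x => (cabs (f x) ^+ 2)%:E) (cst 0%E).
  apply: filterS ae0 => x /[apply] ->.
  by rewrite ComplexField.Normc.normc0 expr0n.
by move=> [/eqP]; rewrite sqrf_eq0 => /eqP.
Qed.

(** Serves the trace, which is linear only up to null sets of the boundary. *)
Lemma L2dot_ae_eql f g h : L2 f -> L2 g -> L2 h ->
  {ae mu, forall x, D x -> f x = g x} -> L2dot mu D f h = L2dot mu D g h.
Proof.
move=> Lf Lg Lh fg; have [ds _ _] := L2dot_hermitian.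
have Lfg := complex_subspaceB isL2_subspace Lf Lg.
apply/eqP; rewrite -subr_eq0 -(sesquilinearBl ds Lf Lg Lh).
apply/eqP/(hermitian_eq0l isL2_subspace L2dot_hermitian Lfg Lh).
rewrite hnorm_L2dot; apply/(L2norm_eq0 Lfg).
by apply: filterS fg => x fgx Dx; rewrite fgx// subrr.
Qed.

Lemma l2norm_re_le f : L2 f -> l2norm mu D (re f) <= L2norm mu D f /\
  l2norm mu D (im f) <= L2norm mu D f.
Proof.
move=> Lf; have /isL2P[rf jf] := Lf.
rewrite -!(@ler_sqr _ _ (L2norm mu D f)) ?nnegrE ?sqrtr_ge0//.
rewrite -!lee_fin -L2norm_sqrE// -!l2norm_sqrE//.
split; apply: ge0_le_integral => //; rewrite ?lee_fin ?sqr_ge0//;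
  try by [move=> x _; rewrite lee_fin sqr_ge0 |
    apply/measurable_EFinP; exact: measurable_cabs_sqr].
- by apply/measurable_EFinP/measurable_funX; case: rf.
- by move=> x _; rewrite lee_fin cabs_sqr lerDl sqr_ge0.
- by apply/measurable_EFinP/measurable_funX; case: jf.
- by move=> x _; rewrite lee_fin cabs_sqr lerDr sqr_ge0.
Qed.

Lemma L2norm_le f : L2 f ->
  L2norm mu D f <= l2norm mu D (re f) + l2norm mu D (im f).
Proof.
move=> Lf; have /isL2P[rf jf] := Lf.
rewrite -ler_sqr ?nnegrE ?addr_ge0 ?sqrtr_ge0//.
rewrite -lee_fin -L2norm_sqrE//.
under eq_integral do rewrite cabs_sqr EFinD.
rewrite ge0_integralD//; try by [move=> x _; rewrite lee_fin sqr_ge0 |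
  apply/measurable_EFinP/measurable_funX; case: rf; case: jf].
rewrite !l2norm_sqrE// -EFinD lee_fin sqrrD.
have : 0 <= l2norm mu D (re f) * l2norm mu D (im f) by rewrite mulr_ge0 ?sqrtr_ge0.
lra.
Qed.

Lemma L2_complete (x : nat -> T -> R[i]) : (forall n, L2 (x n)) ->
  (exists M, forall n, \sum_(k < n) L2norm mu D (fun y => x k.+1 y - x k y) <= M) ->
  exists2 l, L2 l & (fun n => L2norm mu D (fun y => x n y - l y)) @ \oo --> 0.
Proof.
move=> Lx [M xM].
have LB := complex_subspaceB isL2_subspace.
have reB (u v : T -> R[i]) :
    (fun y => complex.Re (u y) - complex.Re (v y)) = re (fun y => u y - v y).
  by apply/funext => y; case: (u y) (v y) => ? ? [].
have imB (u v : T -> R[i]) :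
    (fun y => complex.Im (u y) - complex.Im (v y)) = im (fun y => u y - v y).
  by apply/funext => y; case: (u y) (v y) => ? ? [].
have [||p sp xp] := @square_integrable_complete _ _ _ mu D mD (fun n => re (x n)).
- by move=> n; have /isL2P[] := Lx n.
- exists M => n; apply: le_trans (xM n); apply: ler_sum => k _.
  by rewrite reB; have [] := l2norm_re_le (LB _ _ (Lx k.+1) (Lx k)).
have [||q sq xq] := @square_integrable_complete _ _ _ mu D mD (fun n => im (x n)).
- by move=> n; have /isL2P[] := Lx n.
- exists M => n; apply: le_trans (xM n); apply: ler_sum => k _.
  by rewrite imB; have [] := l2norm_re_le (LB _ _ (Lx k.+1) (Lx k)).
exists (fun y => p y +i* q y); first by apply/isL2P.
have Ll : L2 (fun y => p y +i* q y) by apply/isL2P.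
apply: (@squeeze_cvgr _ _ _ _ (fun=> 0) (fun n =>
  l2norm mu D (fun y => complex.Re (x n y) - p y) +
  l2norm mu D (fun y => complex.Im (x n y) - q y))).
- apply: nearW => n; rewrite sqrtr_ge0/=.
  have := L2norm_le (LB _ _ (Lx n) Ll).
  by rewrite -reB -imB.
- exact: cvg_cst.
- by rewrite -(addr0 0); exact: (cvgD xp xq).
Qed.

End ComplexL2.

(** * Borel sets and boxes in R^3 *)

Section Boxes.
Context {R : realType}.
Implicit Types (c x y : R3 R) (r : R) (Omega U : set (R3 R)).

Definition open_box c r : set (R3 R) :=
  (ball c.1.1 r `*` ball c.1.2 r) `*` ball c.2 r.

Definition closed_box c r : set (R3 R) :=
  (`[c.1.1 - r, c.1.1 + r] `*` `[c.1.2 - r, c.1.2 + r]) `*`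
    `[c.2 - r, c.2 + r].

Lemma compact_closed_box c r : compact (closed_box c r).
Proof.
by apply: compact_setX; [apply: compact_setX|]; exact: segment_compact.
Qed.

Lemma measurable_open_box c r : measurable (open_box c r : set (R3meas R)).
Proof.
by apply: measurableX; [apply: measurableX|]; exact: measurable_ball.
Qed.

Lemma measurable_closed_box c r : measurable (closed_box c r : set (R3meas R)).
Proof.
by apply: measurableX; [apply: measurableX|]; exact: measurable_itv.
Qed.

Lemma leb3_closed_box c r : (leb3 R (closed_box c r) < +oo)%E.
Proof.
have mI (a b : R) : measurable (`[a, b] : set (measurableTypeR R)).
  exact: measurable_itv.
have fin (a b : R) : (lebesgue_measure (`[a, b] : set (measurableTypeR R)) < +oo)%E.
  by rewrite lebesgue_measure_itv/=; case: ifPn => // _; rewrite -EFinB ltry.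
pose mu := @lebesgue_measure R.
have I1 := mI (c.1.1 - r) (c.1.1 + r); have I2 := mI (c.1.2 - r) (c.1.2 + r).
have I3 := mI (c.2 - r) (c.2 + r).
have E2 := @product_measure1E _ _ _ _ R mu mu _ _ I1 I2.
have E3 := @product_measure1E _ _ _ _ R (mu \x mu)%E mu _ _ (measurableX I1 I2) I3.
apply: (@le_lt_trans _ _ (mu `[(c.1.1 - r)%R, (c.1.1 + r)%R]%classic *
  mu `[(c.1.2 - r)%R, (c.1.2 + r)%R]%classic *
  mu `[(c.2 - r)%R, (c.2 + r)%R]%classic)%E).
  by rewrite -E2 -E3.
by rewrite -ge0_fin_numE ?mule_ge0// !fin_numM ?ge0_fin_numE ?fin.
Qed.

Lemma leb3_bounded U : measurable (U : set (R3meas R)) -> bounded_set U ->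
  (leb3 R U < +oo)%E.
Proof.
move=> mU [M [_ /(_ (M + 1))]]; rewrite ltrDl => /(_ ltr01) UM.
apply: le_lt_trans (leb3_closed_box 0 (M + 1)).
apply: le_measure; rewrite ?inE//; first exact: measurable_closed_box.
move=> x /UM /=; rewrite prod_normE /= ge_max prod_normE /= ge_max.
have mem (t r : R) : `|t| <= r -> t \in `[0 - r, 0 + r].
  by rewrite ler_norml in_itv /= sub0r add0r.
by move=> /andP[/andP[? ?] ?]; split; [split|]; exact: mem.
Qed.

(** A countable family with two uses: it writes open sets as countable unions of boxes, hence as
    measurable sets of the product sigma-algebra, and it glues local almost-everywhere
    statements. *)
Definition rational_box (q : rat * rat * rat * nat) :=
  ((ratr q.1.1.1, ratr q.1.1.2, ratr q.1.2) : R3 R, (q.2.+1%:R)^-1 : R).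

Lemma rational_box_cover U x : open U -> U x -> exists q,
  open_box (rational_box q).1 (rational_box q).2 x /\
  closed_box (rational_box q).1 (rational_box q).2 `<=` U.
Proof.
move=> oU Ux; have := open_nbhs_nbhs (conj oU Ux).
rewrite -nbhs_ballE => -[e /= e0 eU].
(* A radius below [e / 2] suffices: in each coordinate, [x] and every point of the closed box are
   within that radius of the centre. *)
have /cvgrPdist_lt/(_ _ (divr_gt0 e0 (ltr0n _ 2)))[k _ kP] := @cvg_harmonic R.
have := kP k (leqnn _); rewrite /= sub0r normrN ger0_norm ?invr_ge0// => ke.
have [r [r0 re rE]] : exists r : R, [/\ 0 < r, r < e / 2 & r = (k.+1%:R)^-1].
  by exists (k.+1%:R)^-1; rewrite invr_gt0.
have rat_near (t : R) : exists q : rat, ball (ratr q : R) r t.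
  have trt : t - r < t + r by rewrite ltrD2l gtrN.
  have [q qP] := rat_in_itvoo trt.
  exists q; rewrite /ball /= ltr_norml; move: qP; rewrite in_itv /= => /andP[? ?].
  by apply/andP; split; lra.
have [q1 P1] := rat_near x.1.1; have [q2 P2] := rat_near x.1.2.
have [q3 P3] := rat_near x.2.
exists (q1, q2, q3, k); rewrite /rational_box /= -rE.
split => // y [[/= Y1 Y2] Y3]; apply: eU.
have near (q : rat) (s t : R) : ball (ratr q : R) r s ->
    t \in `[ratr q - r, ratr q + r] -> ball s e t.
  rewrite /ball /= !ltr_norml in_itv /= => /andP[? ?] /andP[? ?].
  by apply/andP; split; lra.
by split; [split|]; [exact: near P1 Y1|exact: near P2 Y2|exact: near P3 Y3].
Qed.

Lemma open_measurable3 U : open U -> measurable (U : set (R3meas R)).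
Proof.
move=> oU.
rewrite (_ : U = \bigcup_q (if `[< closed_box (rational_box q).1
    (rational_box q).2 `<=` U >] then
    open_box (rational_box q).1 (rational_box q).2 else set0)).
  apply: (@countable_bigcupT_measurable _ (R3meas R)) => // q.
  by case: ifPn => _; [exact: measurable_open_box|exact: measurable0].
apply/seteqP; split=> [x Ux|x [q _]].
  have [q [qx qU]] := rational_box_cover oU Ux.
  by exists q => //; rewrite asboolT.
case: asboolP => // qU [[/= x1 x2] x3]; apply: qU.
have near (s t r : R) : ball s r t -> t \in `[s - r, s + r].
  rewrite /ball/= ltr_norml in_itv /= => /andP[? ?]; apply/andP; split; lra.
by split; [split|]; apply: near.
Qed.

Lemma continuous_measurable3 (f : R3 R -> R) D :
  measurable (D : set (R3meas R)) -> continuous f ->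
  measurable_fun D (f : R3meas R -> R).
Proof.
move=> mD cf; apply: (measurability _ (RGenOpens.measurableE R)) => //.
move=> _ [_ [a [b ->]] <-]; apply: measurableI => //.
by apply: open_measurable3; apply: open_comp => [x _|]; [exact: cf|exact: interval_open].
Qed.

End Boxes.

(** * Test functions *)

Section Flat.
Context {R : realType}.
Implicit Types (p q : {poly R}) (x y : R).

Definition flat p x := if 0 < x then p.[x^-1] * expR (- x^-1) else 0.

Definition flat_deriv p := 'X^2 * (p - p^`()).

(** The exponential dominates each term of its power series, so [y ^+ i * expR (- y)] is at most the
    factorial of [i]. *)
Lemma poly_expRN_bounded p :
  exists C, forall y, 0 < y -> `|p.[y] * expR (- y)| <= C.
Proof.
exists (\sum_(i < size p) `|p`_i| * i`!%:R) => y y0.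
rewrite normrM [`|expR _|]ger0_norm ?expR_ge0// expRN ler_pdivrMr ?expR_gt0//.
rewrite horner_coef mulr_suml; apply: le_trans (ler_norm_sum _ _ _) _.
apply: ler_sum => i _; rewrite normrM -mulrA ler_wpM2l//.
rewrite ger0_norm ?exprn_ge0 ?(ltW y0)//.
case: (nat_of_ord i) => [|n].
  by rewrite expr0 fact0 mul1r -[leLHS]expR0 ler_expR ltW.
have := expR_ge1Dxn n (ltW y0); have n0 : 0 < (n.+1)`!%:R :> R.
  by rewrite ltr0n fact_gt0.
move=> H; rewrite mulrC -ler_pdivrMr//; by apply: le_trans H; rewrite lerDr.
Qed.

Lemma flat_le0 p x : x <= 0 -> flat p x = 0.
Proof. by rewrite /flat leNgt => /negbTE ->. Qed.

(** Quadratic decay makes the difference quotient at 0 tend to 0. It is the boundedness of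
    [p * 'X^2] against the exponential, read at [x^-1]. *)
Lemma flat_sqr_bound p : exists C, forall x, `|flat p x| <= C * x ^+ 2.
Proof.
have [C CP] := poly_expRN_bounded (p * 'X^2).
have C0 : 0 <= C by apply: le_trans (CP 1 ltr01).
exists C => x; rewrite /flat; case: ifPn => [x0|_]; last first.
  by rewrite normr0 mulr_ge0 ?sqr_ge0.
have := CP x^-1; rewrite invr_gt0 => /(_ x0).
rewrite hornerM hornerXn -mulrAC normrM.
rewrite [`|_ ^+ 2|]ger0_norm ?sqr_ge0// exprVn.
by rewrite ler_pdivrMr ?exprn_gt0.
Qed.

Lemma is_derive_flat p x : is_derive x 1 (flat p) (flat (flat_deriv p) x).
Proof.
have [x0|x0|->] := ltgtP x 0.
- rewrite (flat_le0 _ (ltW x0)); apply: (@near_eq_is_derive _ _ _ (cst 0)).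
  by near=> y; rewrite flat_le0//; near: y; exact: lt_le_nbhsl.
- apply: (@near_eq_is_derive _ _ _ (fun y => p.[y^-1] * expR (- y^-1))).
    near=> y; rewrite /flat ifT//; near: y; exact: lt_nbhsr.
  have xn0 : x != 0 by rewrite gt_eqF.
  have dV : is_derive x 1 (fun y => y^-1) (- x ^- 2).
    have := @is_deriveV R id x 1 1 xn0 (is_derive_id _ _).
    by rewrite /GRing.scale/= mulr1.
  have d1 : is_derive x 1 (horner p \o (fun y => y^-1)) (p^`().[x^-1] * - x ^- 2).
    exact: is_derive1_comp.
  have d2 : is_derive x 1 (expR \o (fun y => - y^-1)) (expR (- x^-1) * x ^- 2).
    have dN : is_derive x 1 (fun y => - y^-1) (x ^- 2).
      by rewrite -[x ^- 2]opprK; exact: is_deriveN.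
    exact: is_derive1_comp.
  have := is_deriveM d1 d2; rewrite /flat x0 /flat_deriv.
  rewrite hornerM hornerXn hornerD hornerN /GRing.scale/= exprVn => d3.
  apply: is_derive_eq d3 _; ring.
- rewrite flat_le0//.
  have [C CP] := flat_sqr_bound p.
  have lim0 : (fun h => h^-1 *: ((flat p \o shift 0) (h *: 1) - flat p 0)) @ 0^'
      --> (0 : R).
    apply/cvgr0Pnorm_lt => e e0; have C0 : 0 < `|C| + 1 by rewrite ltr_wpDl.
    near=> h; have h0 : h != 0 by near: h; exact: nbhs_dnbhs_neq.
    rewrite /= [flat p 0]flat_le0// subr0 addr0 /GRing.scale/= mulr1 normrM normfV.
    rewrite ltr_pdivrMl ?normr_gt0//; apply: le_lt_trans (CP h) _.
    rewrite -[h ^+ 2]real_normK ?num_real// expr2 mulrA mulrC ltr_pM2l ?normr_gt0//.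
    apply: (@le_lt_trans _ _ ((`|C| + 1) * `|h|)).
      by rewrite ler_wpM2r// (le_trans (ler_norm C))// lerDl.
    rewrite -ltr_pdivlMl// mulrC; near: h.
    by apply: dnbhs0_lt; rewrite divr_gt0.
  by apply: DeriveDef; [exact: cvgP lim0|exact: cvg_lim lim0].
Unshelve. all: by end_near. Qed.

End Flat.

(** * Smooth functions generated by flat functions of one coordinate *)

Section Elementary.
Context {R : realType}.
Implicit Types (f g : R3 R -> R) (x v : R3 R) (i j : 'I_3).

Definition coord i x : R :=
  if i == 0 :> nat then x.1.1 else if i == 1 :> nat then x.1.2 else x.2.

Lemma diff_coord i x : is_diff x (coord i) (coord i).
Proof.
have c11 : continuous (fst \o fst : R3 R -> R).
  by move=> y; apply: continuous_comp; exact: cvg_fst.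
have c12 : continuous (snd \o fst : R3 R -> R).
  by move=> y; apply: continuous_comp; [exact: cvg_fst|exact: cvg_snd].
have c2 : continuous (snd : R3 R -> R) by move=> y; exact: cvg_snd.
case: i => -[|[|m]] im; apply: DiffDef.
- exact: linear_differentiable c11.
- exact: diff_lin c11.
- exact: linear_differentiable c12.
- exact: diff_lin c12.
- exact: linear_differentiable c2.
- exact: diff_lin c2.
Qed.

Lemma derive_flat_coord p i (a b : R) x v :
  differentiable (fun y => flat p (a * coord i y + b)) x /\
  'D_v (fun y => flat p (a * coord i y + b)) x =
  a * coord i v * flat (flat_deriv p) (a * coord i x + b).
Proof.
have dc := diff_coord i x.
have da : is_diff x (fun y => a * coord i y + b) (fun v => a * coord i v).
  apply: (is_diff_eq (is_diffD (is_diffZ a dc) (is_diff_cst b x))).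
  by apply/funext => y; rewrite !fctE addr0.
have df := is_derive_flat p (a * coord i x + b).
have /derivable1_diffP dflat : derivable (flat p) (a * coord i x + b) 1 by [].
have dflat' : 'd (flat p) (a * coord i x + b) =
    (fun h : R => h *: flat (flat_deriv p) (a * coord i x + b)) :> (R -> R).
  by rewrite diff1E// derive1E derive_val.
have dcomp := differentiable_comp (ex_diff (is_diff_def := da)) dflat.
split; first exact: dcomp.
rewrite (deriveE v dcomp) (diff_comp (ex_diff (is_diff_def := da)) dflat) /=.
by rewrite dflat' diff_val.
Qed.

(** A class of differentiable functions that contains its own partial derivatives; smoothness
    follows by induction on the list of derivatives. *)
Inductive elementary : (R3 R -> R) -> Prop :=
| elementary_flat p i (a b : R) : elementary (fun x => flat p (a * coord i x + b))
| elementary_scale (c : R) f : elementary f -> elementary (fun x => c * f x)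
| elementary_add f g : elementary f -> elementary g ->
    elementary (fun x => f x + g x)
| elementary_mul f g : elementary f -> elementary g ->
    elementary (fun x => f x * g x).

Lemma elementary_partial f : elementary f ->
  (forall x, differentiable f x) /\ forall i, elementary (partial i f).
Proof.
elim=> {f} [p j a b|c f _ [df pf]|f g _ [df pf] _ [dg pg]|f g ef [df pf] eg [dg pg]].
- split=> [x|i]; first by have [] := derive_flat_coord p j a b x 0.
  rewrite (_ : partial i _ = fun x =>
    (a * coord j (unit_vector i)) * flat (flat_deriv p) (a * coord j x + b)).
    exact/elementary_scale/elementary_flat.
  apply/funext => x; rewrite /partial.
  by have [_ ->] := derive_flat_coord p j a b x (unit_vector i).
- split=> [x|i]; first exact: (differentiableZ c (df x)).
  rewrite (_ : partial i _ = fun x => c * partial i f x).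
    exact: elementary_scale.
  by apply/funext => x; rewrite /partial (deriveZ c)//; exact: diff_derivable.
- split=> [x|i]; first exact: (differentiableD (df x) (dg x)).
  rewrite (_ : partial i _ = fun x => partial i f x + partial i g x).
    exact: elementary_add.
  by apply/funext => x; rewrite /partial (deriveD (f := f))//; exact: diff_derivable.
- split=> [x|i]; first exact: (differentiableM (df x) (dg x)).
  rewrite (_ : partial i _ = fun x => f x * partial i g x + g x * partial i f x).
    by apply: elementary_add; apply: elementary_mul.
  by apply/funext => x; rewrite /partial (deriveM (f := f))//; exact: diff_derivable.
Qed.

Lemma elementary_smooth f : elementary f -> smooth f.
Proof.
move=> ef s x; apply: (elementary_partial _).1.
by elim: s => [//|i s IH] /=; exact: (elementary_partial IH).2.
Qed.

End Elementary.

(** * Test functions on a bounded open set *)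

Section TestFunctions.
Context {R : realType}.
Variable Omega : set (R3 R).
Hypothesis oOmega : open Omega.
Hypothesis bOmega : bounded_set Omega.
Implicit Types (phi : R3 R -> R) (i : 'I_3).

Lemma smooth_continuous phi : smooth phi -> continuous phi.
Proof. by move=> sphi x; apply: differentiable_continuous; exact: (sphi [::]). Qed.

(** The complement of the compact set [K] is open, so [phi] vanishes near each of its points and the
    same [K] works for the derivative. *)
Lemma test_function_partial phi i :
  test_function Omega phi -> test_function Omega (partial i phi).
Proof.
move=> [sphi [K [cK KO phiK]]]; split.
  by move=> s x; have := sphi (rcons s i) x; rewrite foldr_rcons.
exists K; split=> // x Kx.
have clK : closed K by apply: compact_closed cK; exact: norm_hausdorff.
have : \forall y \near x, phi y = cst 0 y.
  have := open_nbhs_nbhs (conj (closed_openC clK) Kx).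
  by apply: filterS => y; exact: phiK.
by move=> /(@near_eq_derive _ _ _ _ _ _ (unit_vector i)); rewrite /partial => ->;
  rewrite derive_cst.
Qed.

Lemma test_function_bounded phi : test_function Omega phi ->
  exists M, forall x, `|phi x| <= M.
Proof.
move=> [sphi [K [cK KO phiK]]].
have : bounded_set (phi @` K).
  apply: compact_bounded; apply: continuous_compact => //.
  by apply: continuous_subspaceT; exact: smooth_continuous.
move=> [M [_ /(_ (`|M| + 1))]].
have -> : (M < `|M| + 1) by rewrite (le_lt_trans (ler_norm M))// ltrDl.
move=> /(_ isT) KM; exists (`|M| + 1) => x.
have [Kx|/phiK ->] := pselect (K x); first by apply: KM; exists x.
by rewrite normr0 addr_ge0.
Qed.

Lemma measurable_Omega : measurable (Omega : set (R3meas R)).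
Proof. exact: open_measurable3. Qed.

Lemma test_function_measurable phi : test_function Omega phi ->
  measurable_fun (Omega : set (R3meas R)) phi.
Proof.
move=> [sphi _]; apply: continuous_measurable3; first exact: measurable_Omega.
exact: smooth_continuous.
Qed.

Lemma test_function_L2 phi : test_function Omega phi ->
  L2_Omega Omega (fun x => (phi x)%:C).
Proof.
move=> tphi; have mphi := test_function_measurable tphi.
have mO := measurable_Omega.
apply/(isL2P _ mO); split=> /=; last exact: square_integrable0.
have [M phiM] := test_function_bounded tphi.
have iM : (leb3 R).-integrable Omega (EFin \o (fun=> M ^+ 2)).
  apply: measurable_bounded_integrable => //; first exact: leb3_bounded.
  exists `|M ^+ 2|; split; first exact: num_real.
  by move=> y My x _ /=; exact: ltW.
apply: (le_square_integrable mO mphi iM) => x _ /=.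
rewrite lee_fin -[leLHS]real_normK ?num_real// ler_sqr ?nnegrE//.
exact: le_trans (phiM x).
Qed.

End TestFunctions.

(** * Octants as generators of the Borel sets *)

Section Octants.
Context {R : realType}.

Definition octant (c : R3 R) : set (R3meas R) :=
  (`]c.1.1, +oo[ `*` `]c.1.2, +oo[) `*` `]c.2, +oo[.

Lemma octantP c x : octant c x <->
  [/\ c.1.1 < x.1.1, c.1.2 < x.1.2 & c.2 < x.2].
Proof.
rewrite /octant /= !in_itv /= !andbT.
by split=> [[[? ?] ?]|[]].
Qed.

Lemma measurable_octant c : measurable (octant c).
Proof.
by apply: measurableX; [apply: measurableX|]; exact: measurable_itv.
Qed.

Lemma setI_closed_octant : setI_closed (range octant).
Proof.
move=> _ _ [c _ <-] [e _ <-].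
exists (Num.max c.1.1 e.1.1, Num.max c.1.2 e.1.2, Num.max c.2 e.2) => //.
apply/seteqP; split=> x.
  by move=> /octantP[] /=; rewrite !gt_max => /andP[? ?] /andP[? ?] /andP[? ?];
    split; apply/octantP.
move=> [/octantP[? ? ?] /octantP[? ? ?]]; apply/octantP => /=.
by rewrite !gt_max; split; apply/andP.
Qed.

(** A half-space bounding one coordinate from below is a countable union of octants whose other two
    corner coordinates run to minus infinity. Hence the coordinates, and with them the identity map
    into the product, are measurable for the generated sigma-algebra. *)
Lemma measurable_octantE : (@measurable _ (R3meas R)) = <<s range octant >>.
Proof.
apply/seteqP; split; last first.
  apply: smallest_sub; first exact: sigma_algebra_measurable.
  by move=> _ [c _ <-]; exact: measurable_octant.
pose O := g_sigma_algebraType (range octant).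
have mO (c : R3 R) : measurable (octant c : set O).
  by apply: sub_sigma_algebra; exists c.
have natN (t : R) : exists n : nat, - n%:R < t.
  exists (Num.bound `|t|); rewrite ltrNl.
  by rewrite (le_lt_trans (ler_norm _))// normrN archi_boundP.
have mcoord (f : R3 R -> R) (c : R -> R -> R3 R) :
    (forall a x, a < f x <-> exists n : nat, octant (c a (- n%:R)) x) ->
    measurable_fun [set: O] (f : O -> measurableTypeR R).
  move=> fP; apply: (measurability _ (RGenOInfty.measurableE R)) => //.
  move=> _ [_ [a ->] <-]; rewrite setTI.
  rewrite (_ : _ @^-1` _ = \bigcup_n octant (c a (- n%:R))); last first.
    apply/seteqP; split=> x /=.
      by rewrite in_itv/= andbT => /fP[n ?]; exists n.
    by move=> [n _ ?]; rewrite in_itv/= andbT; apply/fP; exists n.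
  by apply: bigcup_measurable => n _; exact: mO.
have nat2 (s t : R) : exists n : nat, - n%:R < s /\ - n%:R < t.
  have [n ns] := natN s; have [m mt] := natN t.
  exists (maxn n m); split.
    by apply: le_lt_trans ns; rewrite lerN2 ler_nat leq_maxl.
  by apply: le_lt_trans mt; rewrite lerN2 ler_nat leq_maxr.
have m1 : measurable_fun [set: O] ((fun x => x.1.1) : O -> measurableTypeR R).
  apply: (mcoord _ (fun a b => (a, b, b))) => a x; split.
    have [n [? ?]] := nat2 x.1.2 x.2.
    by move=> ax; exists n; apply/octantP.
  by move=> [n /octantP[]].
have m2 : measurable_fun [set: O] ((fun x => x.1.2) : O -> measurableTypeR R).
  apply: (mcoord _ (fun a b => (b, a, b))) => a x; split.
    have [n [? ?]] := nat2 x.1.1 x.2.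
    by move=> ax; exists n; apply/octantP.
  by move=> [n /octantP[]].
have m3 : measurable_fun [set: O] ((fun x => x.2) : O -> measurableTypeR R).
  apply: (mcoord _ (fun a b => (b, b, a))) => a x; split.
    have [n [? ?]] := nat2 x.1.1 x.1.2.
    by move=> ax; exists n; apply/octantP.
  by move=> [n /octantP[]].
have mid := measurable_fun_pair (measurable_fun_pair m1 m2) m3.
move=> A mA; have := mid measurableT A mA; rewrite setTI.
rewrite (_ : _ @^-1` A = A)//.
by apply/seteqP; split=> -[[? ?] ?].
Qed.

End Octants.

(** * The fundamental lemma of the calculus of variations *)

Section Bumps.
Context {R : realType}.
Implicit Types (t : R) (c x : R3 R).

Lemma flat1E t : 0 < t -> flat 1 t = expR (- t^-1).
Proof. by move=> t0; rewrite /flat t0 hornerC mul1r. Qed.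

Lemma flat1_bounds t : 0 <= flat 1 t <= 1.
Proof.
have [t0|t0] := leP t 0; first by rewrite flat_le0// lexx ler01.
by rewrite flat1E// expR_ge0/= -[leRHS]expR0 ler_expR oppr_le0 invr_ge0 ltW.
Qed.

Lemma flat1_gt0 t : (0 < flat 1 t) = (0 < t).
Proof.
have [t0|t0] := leP t 0; first by rewrite flat_le0// ltxx.
by rewrite flat1E// expR_gt0.
Qed.

(** Every term vanishes at [t = 0], so the limit is the indicator of the open half-line at every
    point, in agreement with the strict inequalities of [octant]. *)
Lemma cvg_flat1_scale t : (fun n => flat 1 (n.+1%:R * t)) @ \oo --> ((0 < t)%R%:R : R).
Proof.
have [t0|t0] := leP t 0.
  under eq_fun do rewrite flat_le0 ?pmulr_rle0//.
  exact: cvg_cst.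
have lim0 : (fun n => - (n.+1%:R * t)^-1) @ \oo --> (0 : R).
  rewrite -[0]oppr0; apply: cvgN; under eq_fun do rewrite invfM.
  by rewrite -(mul0r t^-1); apply: cvgMr_tmp; exact: cvg_harmonic.
have := cvg_comp _ _ lim0 (@continuous_expR R 0); rewrite expR0; apply: cvg_trans.
by apply: near_eq_cvg; apply: nearW => n; rewrite /= flat1E ?mulr_gt0.
Qed.

Local Notation i0 := (@Ordinal 3 0 isT).
Local Notation i1 := (@Ordinal 3 1 isT).
Local Notation i2 := (@Ordinal 3 2 isT).

(* Each factor is positive exactly where the affine function inside is. *)
Definition bump6 (a1 b1 a2 b2 a3 b3 : R) x : R :=
  flat 1 (a1 * coord i0 x + b1) * flat 1 (a2 * coord i1 x + b2) *
  flat 1 (a3 * coord i2 x + b3).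

(** In each coordinate the two affine arguments are [x - (c - r)] and [(c + r) - x], both positive
    exactly inside the box. *)
Definition box_bump c (r : R) x :=
  bump6 1 (r - c.1.1) 1 (r - c.1.2) 1 (r - c.2) x *
  bump6 (-1) (r + c.1.1) (-1) (r + c.1.2) (-1) (r + c.2) x.

Definition octant_bump c n x :=
  bump6 n.+1%:R (- (n.+1%:R * c.1.1)) n.+1%:R (- (n.+1%:R * c.1.2))
    n.+1%:R (- (n.+1%:R * c.2)) x.

Lemma bump6_elementary a1 b1 a2 b2 a3 b3 :
  elementary (bump6 a1 b1 a2 b2 a3 b3).
Proof. by do 2?apply: elementary_mul; exact: elementary_flat. Qed.

Lemma bump6_bounds a1 b1 a2 b2 a3 b3 x : 0 <= bump6 a1 b1 a2 b2 a3 b3 x <= 1.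
Proof.
rewrite /bump6.
have /andP[p0 p1] := flat1_bounds (a1 * coord i0 x + b1).
have /andP[q0 q1] := flat1_bounds (a2 * coord i1 x + b2).
have /andP[s0 s1] := flat1_bounds (a3 * coord i2 x + b3).
by rewrite !mulr_ge0//= !mulr_ile1 ?mulr_ge0.
Qed.

Lemma bump6_gt0 a1 b1 a2 b2 a3 b3 x : 0 < bump6 a1 b1 a2 b2 a3 b3 x <->
  [/\ 0 < a1 * x.1.1 + b1, 0 < a2 * x.1.2 + b2 & 0 < a3 * x.2 + b3].
Proof.
split=> [|[? ? ?]]; last by rewrite /bump6 !mulr_gt0 ?flat1_gt0.
rewrite /bump6 /coord /=.
have [|p] := leP (a1 * x.1.1 + b1) 0.
  by move/(flat_le0 1) => ->; rewrite !mul0r ltxx.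
have [|q] := leP (a2 * x.1.2 + b2) 0.
  by move/(flat_le0 1) => ->; rewrite mulr0 mul0r ltxx.
have [|//] := leP (a3 * x.2 + b3) 0.
by move/(flat_le0 1) => ->; rewrite mulr0 ltxx.
Qed.

Lemma box_bump_bounds c r x : 0 <= box_bump c r x <= 1.
Proof.
rewrite /box_bump.
have /andP[p0 p1] := bump6_bounds 1 (r - c.1.1) 1 (r - c.1.2) 1 (r - c.2) x.
have /andP[q0 q1] := bump6_bounds (-1) (r + c.1.1) (-1) (r + c.1.2) (-1) (r + c.2) x.
by rewrite mulr_ge0//= mulr_ile1.
Qed.

Lemma box_bump_gt0 c r x : open_box c r x -> 0 < box_bump c r x.
Proof.
rewrite /open_box /ball /= => -[[]]; rewrite !ltr_norml.
move=> /andP[? ?] /andP[? ?] /andP[? ?].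
by apply: mulr_gt0; apply/bump6_gt0; split; lra.
Qed.

Lemma box_bump_eq0 c r x : ~ closed_box c r x -> box_bump c r x = 0.
Proof.
move=> cx; have /andP[b0 _] := box_bump_bounds c r x.
apply/eqP; apply: contra_notT cx => bx.
have : 0 < box_bump c r x by rewrite lt_def bx.
rewrite /box_bump.
have /andP[p0 p1] := bump6_bounds 1 (r - c.1.1) 1 (r - c.1.2) 1 (r - c.2) x.
have /andP[q0 q1] := bump6_bounds (-1) (r + c.1.1) (-1) (r + c.1.2) (-1) (r + c.2) x.
move=> pq0.
have {}p0 : 0 < bump6 1 (r - c.1.1) 1 (r - c.1.2) 1 (r - c.2) x.
  rewrite lt_def p0 andbT; apply: contraTneq pq0 => ->.
  by rewrite mul0r ltxx.
move: pq0; rewrite pmulr_rgt0// => {}q0.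
move/bump6_gt0: p0 => [? ? ?]; move/bump6_gt0: q0 => [? ? ?].
rewrite /closed_box /= !in_itv /=.
by split; [split|]; apply/andP; split; lra.
Qed.

Lemma octant_bump_bounds c n x : 0 <= octant_bump c n x <= 1.
Proof. exact: bump6_bounds. Qed.

Lemma cvg_octant_bump c x :
  (fun n => octant_bump c n x) @ \oo --> (\1_(octant c) x : R).
Proof.
rewrite /octant_bump /bump6.
under eq_fun do rewrite -!mulrN -!mulrDr.
have -> : (\1_(octant c) x : R) =
    (0 < coord i0 x - c.1.1)%R%:R * (0 < coord i1 x - c.1.2)%R%:R *
    (0 < coord i2 x - c.2)%R%:R.
  rewrite indicE /coord /= !subr_gt0 -!natrM !mulnb; congr (_%:R); congr nat_of_bool.
  apply/idP/idP; rewrite inE.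
    by move=> /octantP[-> -> ->].
  by move=> /andP[/andP[? ?] ?]; apply/octantP.
by apply: cvgM; [apply: cvgM|]; exact: cvg_flat1_scale.
Qed.

Lemma test_function_box_bump (Omega : set (R3 R)) c r f : elementary f ->
  closed_box c r `<=` Omega -> test_function Omega (fun x => box_bump c r x * f x).
Proof.
move=> ef cO; split.
  apply: elementary_smooth; apply: elementary_mul => //.
  by apply: elementary_mul; exact: bump6_elementary.
exists (closed_box c r); split => //; first exact: compact_closed_box.
by move=> x /box_bump_eq0 ->; rewrite mul0r.
Qed.

End Bumps.

(* Stated for a variable type: instances of [Filter (almost_everywhere _)] are
   not found on [R3 R]. *)
Lemma ae_imply d (T : measurableType d) (R : realType)
    (mu : {measure set T -> \bar R}) (P Q : T -> Prop) :
  (forall x, P x -> Q x) -> {ae mu, forall x, P x} -> {ae mu, forall x, Q x}.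
Proof. by move=> PQ; apply: filterS. Qed.

Section FundamentalLemma.
Context {R : realType}.
Variable Omega : set (R3 R).
Hypothesis oOmega : open Omega.
Variable g : R3 R -> R.
Hypothesis ig : (leb3 R).-integrable Omega (EFin \o g).
Hypothesis gphi : forall phi, test_function Omega phi ->
  Rintegral (leb3 R) Omega (fun x => g x * phi x) = 0.

Local Notation mu := (leb3 R).
Let mO := measurable_Omega oOmega.

Let mg : measurable_fun (Omega : set (R3meas R)) g.
Proof. by apply/measurable_EFinP; case/integrableP: ig. Qed.

Lemma integrable_mul_bounded (f : R3 R -> R) :
  measurable_fun (Omega : set (R3meas R)) f ->
  (forall x, 0 <= f x <= 1) -> mu.-integrable Omega (fun x => (g x * f x)%:E).
Proof.
move=> mf f01; apply: le_integrable ig => //.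
  by apply/measurable_EFinP/measurable_funM.
move=> x _ /=; rewrite lee_fin normrM ler_piMr//.
by have /andP[? ?] := f01 x; rewrite ger0_norm.
Qed.

(** Octant bumps do not have compact support in [Omega]; the factor [chi] provides it, and can be
    divided out at the end because it is positive on the open box. *)
Lemma box_ae_eq0 c r : closed_box c r `<=` Omega ->
  {ae mu, forall x, Omega x -> open_box c r x -> g x = 0}.
Proof.
move=> cO; pose chi := box_bump c r.
have chi01 x : 0 <= chi x <= 1 := box_bump_bounds c r x.
have chie : elementary chi by apply: elementary_mul; exact: bump6_elementary.
have mul01 (p q : R) : 0 <= p <= 1 -> 0 <= q <= 1 -> 0 <= p * q <= 1.
  by move=> /andP[? ?] /andP[? ?]; rewrite mulr_ge0//= mulr_ile1.
have int0 f : elementary f -> (forall x, 0 <= f x <= 1) ->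
    (\int[mu]_(x in Omega) (g x * (chi x * f x))%:E = 0)%E.
  move=> fe f01; have tf := test_function_box_bump fe cO.
  have fin := integrable_fin_num mO (integrable_mul_bounded
    (test_function_measurable oOmega tf) (fun x => mul01 _ _ (chi01 x) (f01 x))).
  by rewrite -[LHS]fineK// -/(Rintegral _ _ _) gphi.
(* [chi] is squared so that its second copy can be the [f] of [int0], alone for the integral over
   the whole space and multiplied by an octant bump for octants. *)
pose G (x : R3meas R) := (g x * (chi x * chi x))%:E.
have iG : mu.-integrable Omega G.
  apply: integrable_mul_bounded; last by move=> x; exact: mul01.
  exact: (test_function_measurable oOmega (test_function_box_bump chie cO)).
pose F := G \_ Omega.
have iF : mu.-integrable setT F by apply/(integrable_mkcond G mO).
have mF : measurable_fun [set: R3meas R] F by case/integrableP: iF.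
have FT : (\int[mu]_x F x = 0)%E by rewrite /F -integral_mkcond int0.
have FQ q : (\int[mu]_(x in octant q) F x = 0)%E.
  have -> : (\int[mu]_(x in octant q) F x =
      \int[mu]_(x in Omega) (g x * (chi x * (chi x * \1_(octant q) x)))%:E)%E.
    rewrite integral_mkcond [RHS]integral_mkcond; apply: eq_integral => x _.
    rewrite /F /G !patchE indicE; case: (x \in octant q) => //.
      by rewrite mulr1.
    by case: ifP => // _; rewrite !mulr0.
  have mfn n : measurable_fun (Omega : set (R3meas R))
      (fun x => (g x * (chi x * (chi x * octant_bump q n x)))%:E).
    apply/measurable_EFinP/measurable_funM => //.
    apply: (test_function_measurable oOmega); apply: test_function_box_bump => //.
    by apply: elementary_mul => //; exact: bump6_elementary.
  have cvgn x : (fun n => (g x * (chi x * (chi x * octant_bump q n x)))%:E) @ \oo -->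
      (g x * (chi x * (chi x * \1_(octant q) x)))%:E.
    apply: cvg_EFin; first exact: nearW.
    by do 3 apply: cvgMl_tmp; exact: cvg_octant_bump.
  have mlim : measurable_fun (Omega : set (R3meas R))
      (fun x => (g x * (chi x * (chi x * \1_(octant q) x)))%:E).
    exact: (emeasurable_fun_cvg _ _ mfn).
  have domg : {ae mu, forall x n, Omega x ->
      (`|(g x * (chi x * (chi x * octant_bump q n x)))%:E| <= `|(EFin \o g) x|)%E}.
    apply: aeW => x n _; rewrite /= lee_fin normrM ler_piMr//.
    have /andP[? ?] :=
      mul01 _ _ (chi01 x) (mul01 _ _ (chi01 x) (octant_bump_bounds q n x)).
    by rewrite ger0_norm.
  have cvga : {ae mu, forall x, Omega x ->
      (fun n => (g x * (chi x * (chi x * octant_bump q n x)))%:E) @ \oo -->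
      (g x * (chi x * (chi x * \1_(octant q) x)))%:E}.
    by apply: aeW => x _; exact: cvgn.
  have -> : 0%E = limn (fun n => \int[mu]_(x in Omega)
      (g x * (chi x * (chi x * octant_bump q n x)))%:E)%E.
    rewrite [X in limn X](_ : _ = fun=> 0%E) ?lim_cst//.
    apply/funext => n; apply: (int0 (fun x => chi x * octant_bump q n x)).
      by apply: elementary_mul => //; exact: bump6_elementary.
    by move=> x; exact: (mul01 _ _ (chi01 x) (octant_bump_bounds q n x)).
  have [_ _ /cvg_lim lim] := dominated_convergence mO mfn mlim cvga
    (integrable_abse ig) domg.
  by rewrite -lim.
(* The sets over which [F] integrates to 0 form a Dynkin system. Complements are taken in the whole
   space, hence the extension of [G] by 0 outside [Omega]. *)
have FA A : measurable (A : set (R3meas R)) -> (\int[mu]_(x in A) F x = 0)%E.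
  rewrite measurable_octantE; 
  apply: (@dynkin_induction _ (R3meas R) (range octant)
    [set B | \int[mu]_(x in B) F x = 0]%E measurable_octantE) => //.
  - exact: setI_closed_octant.
  - by move=> _ [q _ <-]; exact: FQ.
  - move=> B mB FB; have := FT.
    rewrite -(setUv B) integral_setU//; [by rewrite FB add0e|exact: measurableC|..].
    + by rewrite setUv.
    + by rewrite disj_set2E setICr.
  - move=> B mB tB FB /=; rewrite integral_bigcup//.
      by apply: eseries0 => n _ _; exact: FB.
    by apply: integrableS iF => //; exact: bigcup_measurable.
have : ae_eq mu setT F (cst 0%E).
  apply: integral_ae_eq => // E _ mE.
  by rewrite FA// integral0.
apply: filterS => x /(_ I); rewrite /F /G patchE => Fx Ox cx.
have chi0 : chi x * chi x != 0 by rewrite mulf_neq0// gt_eqF// box_bump_gt0.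
move: Fx; rewrite mem_set// => -[gc].
by apply: (mulIf chi0); rewrite mul0r; exact: gc.
Qed.

Lemma fundamental_lemma : {ae mu, forall x, Omega x -> g x = 0}.
Proof.
have cov q : {ae mu, forall x, Omega x ->
    closed_box (rational_box q).1 (rational_box q).2 `<=` Omega ->
    open_box (rational_box q).1 (rational_box q).2 x -> g x = 0}.
  have [qO|nq] := pselect (closed_box (rational_box q).1 (rational_box q).2 `<=` Omega).
    by apply: (ae_imply (T := R3meas R)) (box_ae_eq0 qO) => x gx Ox _; exact: gx.
  by apply: aeW => x _ /nq.
(* The boxes are enumerated by naturals through [unpickle], so that one null set serves all of
   them. *)
have /(@ae_foralln _ (R3meas R)) : forall n, {ae mu, forall x q,
    unpickle n = Some q -> Omega x ->
    closed_box (rational_box q).1 (rational_box q).2 `<=` Omega ->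
    open_box (rational_box q).1 (rational_box q).2 x -> g x = 0}.
  move=> n; case En : (unpickle n) => [q|]; last by apply: aeW.
  by apply: (ae_imply (T := R3meas R)) (cov q) => x gx _ [<-].
apply: (ae_imply (T := R3meas R)) => x gx Ox.
have [q [qx qO]] := rational_box_cover oOmega Ox.
exact: (gx (pickle q) q (pickleK q)).
Qed.

End FundamentalLemma.

(** * The Hilbert space H^1 *)

Lemma cvg_sum0 (R : realType) (I : Type) (r : seq I) (F : I -> nat -> R) :
  (forall i, F i @ \oo --> 0) -> (fun n => \sum_(i <- r) F i n) @ \oo --> (0 : R).
Proof.
move=> F0; elim: r => [|i r IH].
  by under eq_fun do rewrite big_nil; exact: cvg_cst.
rewrite (_ : (fun n => _) = fun n => F i n + \sum_(j <- r) F j n).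
  by have := @cvgD R R nat \oo _ _ _ 0 0 (F0 i) IH; rewrite addr0; apply.
by apply/funext => n; rewrite big_cons.
Qed.

Section H1Space.
Context {R : realType}.
Variable Omega : set (R3 R).
Hypothesis oOmega : open Omega.
Hypothesis bOmega : bounded_set Omega.
Implicit Types (u v w g h f : R3 R -> R[i]) (phi : R3 R -> R) (i : 'I_3)
  (a : R[i]) (rho : R).

Local Notation L2 := (L2_Omega Omega).
Local Notation dot := (dot Omega).
Local Notation norm := (norm Omega).
Local Notation H1 := (H1 Omega).
Local Notation wp := (weak_partial Omega).
Local Notation weak i u g := (is_weak_partial Omega i u g).
Let mO := measurable_Omega oOmega.
Let L2sub : complex_subspace L2 := isL2_subspace (leb3 R) mO.
Let dotH : hermitian_nonneg_on L2 dot := L2dot_hermitian (leb3 R) mO.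

Lemma norm_ge0 u : 0 <= norm u.
Proof. exact: sqrtr_ge0. Qed.

Lemma hnorm_dot u : hnorm dot u = norm u.
Proof. exact: hnorm_L2dot. Qed.

Lemma cintegral_test u phi :
  cintegral (leb3 R) Omega (fun x => u x * (phi x)%:C) = dot u (fun x => (phi x)%:C).
Proof.
rewrite /Defs.dot /L2dot; congr cintegral; apply/funext => x; congr (_ * _).
by apply: complex_eq; rewrite //= oppr0.
Qed.

Lemma weakE i u g : weak i u g <-> L2 g /\ forall phi, test_function Omega phi ->
  dot u (fun x => (partial i phi x)%:C) = - dot g (fun x => (phi x)%:C).
Proof.
split=> -[Lg gP]; split=> // phi tphi; have := gP _ tphi;
by rewrite !cintegral_test.
Qed.

Lemma dot_test_eq0 h : L2 h ->
  (forall phi, test_function Omega phi -> dot h (fun x => (phi x)%:C) = 0) ->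
  norm h = 0.
Proof.
move=> Lh h0; have /(isL2P _ mO)[rh jh] := Lh.
have iR (q : R3 R -> R) : square_integrable (leb3 R) Omega q ->
    (leb3 R).-integrable Omega (EFin \o q).
  move=> sq; have s1 : square_integrable (leb3 R) Omega (fun=> 1).
    split; first exact: measurable_cst.
    under eq_integral do rewrite expr1n.
    by rewrite integral_cst// mul1e; exact: leb3_bounded.
  have := integrable_mul mO sq s1.
  by apply: eq_integrable => // x _; rewrite /= mulr1.
have fl (q : R3 R -> R) : square_integrable (leb3 R) Omega q ->
    (forall phi, test_function Omega phi ->
      Rintegral (leb3 R) Omega (fun x => q x * phi x) = 0) ->
    {ae leb3 R, forall x, Omega x -> q x = 0}.
  by move=> sq; apply: fundamental_lemma => //; exact: iR.
have pair0 phi : test_function Omega phi ->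
    Rintegral (leb3 R) Omega (fun x => complex.Re (h x) * phi x) = 0 /\
    Rintegral (leb3 R) Omega (fun x => complex.Im (h x) * phi x) = 0.
  move=> tphi; have := h0 _ tphi; rewrite -cintegral_test => -[].
  rewrite (_ : (fun x => complex.Re _) = fun x => complex.Re (h x) * phi x); last first.
    by apply/funext => x; case: (h x) => p q /=; ring.
  rewrite (_ : (fun x => complex.Im _) = fun x => complex.Im (h x) * phi x)//.
  by apply/funext => x; case: (h x) => p q /=; ring.
have re0 := fl _ rh (fun phi tphi => (pair0 phi tphi).1).
have im0 := fl _ jh (fun phi tphi => (pair0 phi tphi).2).
apply/(L2norm_eq0 mO Lh).
have := negligibleU re0 im0; rewrite -setCI; apply: (ae_imply (T := R3meas R)).
by move=> x [r0 i0] Ox; apply: complex_eq; [exact: r0|exact: i0].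
Qed.

Lemma weak_partial_unique i u g h : weak i u g -> weak i u h ->
  norm (fun x => g x - h x) = 0.
Proof.
move=> /weakE[Lg gP] /weakE[Lh hP]; apply: dot_test_eq0.
  exact: complex_subspaceB.
move=> phi tphi; have Lphi := test_function_L2 oOmega bOmega tphi.
case: (dotH) => ds _ _; rewrite (sesquilinearBl ds)//.
by rewrite -[dot g _]opprK -gP// hP// opprK subrr.
Qed.

Lemma weak_lin i a u v g h : L2 u -> L2 v -> weak i u g -> weak i v h ->
  weak i (fun x => a * u x + v x) (fun x => a * g x + h x).
Proof.
move=> Lu Lv /weakE[Lg gP] /weakE[Lh hP]; apply/weakE; split.
  by case: L2sub => _; apply.
move=> phi tphi; have Lphi := test_function_L2 oOmega bOmega tphi.
have Lpphi := test_function_L2 oOmega bOmega (test_function_partial i tphi).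
case: (dotH) => -[dl _] _ _; rewrite !dl// gP// hP//.
by rewrite opprD mulrN.
Qed.

Lemma H1_L2 u : H1 u -> L2 u.
Proof. by case. Qed.

Lemma weak_partialP i u : H1 u -> weak i u (wp i u).
Proof. by move=> [_ /(_ i) ex]; exact: (xgetPex (fun=> 0) ex). Qed.

Lemma weak_partial_L2 i u : H1 u -> L2 (wp i u).
Proof. by move=> /(weak_partialP i)[]. Qed.

Lemma norm_weak_partial i u g : weak i u g -> H1 u ->
  norm (fun x => wp i u x - g x) = 0.
Proof. by move=> gP Hu; apply: weak_partial_unique gP; exact: weak_partialP. Qed.

Lemma dot_weak_partial i u g f : H1 u -> weak i u g -> L2 f -> dot (wp i u) f = dot g f.
Proof.
move=> Hu gP Lf; have Lg := gP.1; have Lw := weak_partial_L2 i Hu.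
case: (dotH) => ds _ _; apply/eqP; rewrite -subr_eq0 -(sesquilinearBl ds)//.
apply/eqP/(hermitian_eq0l L2sub dotH) => //; first exact: complex_subspaceB.
by rewrite hnorm_dot norm_weak_partial.
Qed.

Lemma weak_norm0 i u : L2 u -> norm u = 0 -> weak i u (fun=> 0).
Proof.
move=> Lu u0; have [L0 _] := L2sub; apply/weakE; split=> // phi tphi.
have Lphi := test_function_L2 oOmega bOmega tphi.
have Lpphi := test_function_L2 oOmega bOmega (test_function_partial i tphi).
case: (dotH) => ds _ _; rewrite (sesquilinear0l L2sub ds)// oppr0.
by apply: (hermitian_eq0l L2sub dotH); rewrite ?hnorm_dot.
Qed.

Lemma norm0 : norm (fun=> 0) = 0.
Proof.
have [L0 _] := L2sub; case: (dotH) => ds _ _.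
by rewrite -hnorm_dot /hnorm (sesquilinear0l L2sub ds)//= sqrtr0.
Qed.

Lemma H1_subspace : complex_subspace H1.
Proof.
have [L0 LD] := L2sub; split.
  by split=> // i; exists (fun=> 0); apply: weak_norm0 => //; exact: norm0.
move=> a u v Hu Hv; split; first by apply: LD; exact: H1_L2.
move=> i; exists (fun x => a * wp i u x + wp i v x).
by apply: weak_lin; [exact: H1_L2|exact: H1_L2|exact: weak_partialP..].
Qed.

Lemma dot_weak_partial_lin i a u v f : H1 u -> H1 v -> L2 f ->
  dot (wp i (fun x => a * u x + v x)) f = a * dot (wp i u) f + dot (wp i v) f.
Proof.
move=> Hu Hv Lf; have [_ HD] := H1_subspace.
rewrite (dot_weak_partial (g := fun x => a * wp i u x + wp i v x))//.
- by case: (dotH) => -[dl _] _ _; rewrite dl//; exact: weak_partial_L2.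
- exact: HD.
- by apply: weak_lin; [exact: H1_L2|exact: H1_L2|exact: weak_partialP..].
Qed.

Lemma weak_sub i u v g h : L2 u -> L2 v -> weak i u g -> weak i v h ->
  weak i (fun x => u x - v x) (fun x => g x - h x).
Proof.
have subE (p q : R3 R -> R[i]) : (fun x => p x - q x) = fun x => -1 * q x + p x.
  by apply/funext => x; rewrite mulN1r addrC.
by move=> Lu Lv ug vh; rewrite !subE; exact: weak_lin.
Qed.

Lemma L2norm_congr u v : L2 u -> L2 v -> norm (fun x => u x - v x) = 0 ->
  norm u = norm v.
Proof.
move=> Lu Lv uv0; rewrite -!hnorm_dot; congr Num.sqrt.
have Luv := complex_subspaceB L2sub Lu Lv.
case: (dotH) => ds dC _.
have E w : L2 w -> dot u w = dot v w.
  move=> Lw; apply/eqP; rewrite -subr_eq0 -(sesquilinearBl ds)//.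
  by apply/eqP/(hermitian_eq0l L2sub dotH); rewrite ?hnorm_dot.
by rewrite E// dC// E// -dC.
Qed.

Lemma norm_weak_partialB i u v g : H1 u -> H1 v -> weak i v g ->
  norm (wp i (fun x => u x - v x)) = norm (fun x => wp i u x - g x).
Proof.
move=> Hu Hv vg; have Huv := complex_subspaceB H1_subspace Hu Hv.
have wuv := weak_sub (H1_L2 Hu) (H1_L2 Hv) (weak_partialP i Hu) vg.
apply: L2norm_congr; [exact: weak_partial_L2|exact: wuv.1|].
exact: norm_weak_partial.
Qed.

Lemma gdot_hermitian : hermitian_nonneg_on H1 (gdot Omega).
Proof.
have [_ HD] := H1_subspace; case: (dotH) => -[_ dr] dC d0.
have gC u v : H1 u -> H1 v -> gdot Omega v u = (gdot Omega u v)^*.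
  move=> Hu Hv; rewrite /gdot rmorph_sum; apply: eq_bigr => i _.
  by rewrite dC//; exact: weak_partial_L2.
have gl a u v w : H1 u -> H1 v -> H1 w -> gdot Omega (fun x => a * u x + v x) w =
    a * gdot Omega u w + gdot Omega v w.
  move=> Hu Hv Hw; rewrite /gdot mulr_sumr -big_split; apply: eq_bigr => i _.
  by rewrite dot_weak_partial_lin//; exact: weak_partial_L2.
split; [split; first exact: gl|exact: gC|].
- move=> a u v w Hu Hv Hw; have Hauv := HD a _ _ Hu Hv.
  by rewrite (gC _ _ Hauv Hw) gl// (gC u w)// (gC v w)// rmorphD rmorphM.
- move=> u Hu; rewrite /gdot raddf_sum; apply: sumr_ge0 => i _.
  by apply: d0; exact: weak_partial_L2.
Qed.

Definition energy rho u v : R[i] := gdot Omega u v + (rho ^+ 2)%:C * dot u v.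

Lemma energy_hermitian rho : hermitian_nonneg_on H1 (energy rho).
Proof.
have [[gl gr] gC g0] := gdot_hermitian; have [[dl dr] dC d0] := dotH.
have comb (a p q r s t : R[i]) :
    a * p + q + r * (a * s + t) = a * (p + r * s) + (q + r * t) by ring.
split; first split.
- move=> a u v w Hu Hv Hw; rewrite /energy (gl a u v w Hu Hv Hw).
  by rewrite (dl a u v w (H1_L2 Hu) (H1_L2 Hv) (H1_L2 Hw)) comb.
- move=> a u v w Hu Hv Hw; rewrite /energy (gr a u v w Hu Hv Hw).
  by rewrite (dr a u v w (H1_L2 Hu) (H1_L2 Hv) (H1_L2 Hw)) comb.
- move=> u v Hu Hv; rewrite /energy (gC u v Hu Hv).
  rewrite (dC u v (H1_L2 Hu) (H1_L2 Hv)).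
  exact/esym/conjcD_real.
- move=> u Hu; have := g0 _ Hu; have := d0 _ (H1_L2 Hu); rewrite /energy.
  case: (gdot Omega u u) (dot u u) => p q [s t] /= s0 p0.
  by rewrite mul0r subr0 addr_ge0// mulr_ge0// sqr_ge0.
Qed.

Lemma rho_normE rho u : rho_norm Omega rho u = hnorm (energy rho) u.
Proof.
have E v : complex.Re (dot v v) = norm v ^+ 2.
  rewrite -hnorm_dot /hnorm sqr_sqrtr//.
  apply: Rintegral_ge0 => x _.
  by rewrite mulcJ /= sqr_ge0.
have ReDM (r : R) (z w : R[i]) : complex.Re (z + r%:C * w) =
    complex.Re z + r * complex.Re w.
  by case: z w => p q [s t] /=; rewrite mul0r subr0.
congr Num.sqrt; rewrite [RHS]ReDM E /gdot raddf_sum; congr (_ + _).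
by apply: eq_bigr => i _; rewrite -E.
Qed.

Lemma rho_norm_sqr rho u : rho_norm Omega rho u ^+ 2 =
  \sum_(i < 3) norm (wp i u) ^+ 2 + rho ^+ 2 * norm u ^+ 2.
Proof.
rewrite sqr_sqrtr//; apply: addr_ge0; last by rewrite mulr_ge0 ?sqr_ge0.
by apply: sumr_ge0 => i _; exact: sqr_ge0.
Qed.

Lemma norm_le_rho_norm rho u : 1 <= rho -> norm u <= rho_norm Omega rho u.
Proof.
move=> rho1; rewrite -ler_sqr ?nnegrE ?sqrtr_ge0// rho_norm_sqr.
apply: ler_wpDl; first by apply: sumr_ge0 => i _; exact: sqr_ge0.
by apply: ler_peMl; [exact: sqr_ge0|exact: exprn_ege1].
Qed.

Lemma norm_weak_le_rho_norm rho i u : norm (wp i u) <= rho_norm Omega rho u.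
Proof.
rewrite -ler_sqr ?nnegrE ?sqrtr_ge0// rho_norm_sqr (bigD1 i)//= -addrA lerDl.
apply: addr_ge0; last by rewrite mulr_ge0 ?sqr_ge0.
by apply: sumr_ge0 => j _; exact: sqr_ge0.
Qed.

Lemma rho_norm1_le rho u : 1 <= rho -> rho_norm Omega 1 u <= rho_norm Omega rho u.
Proof.
move=> rho1; rewrite -ler_sqr ?nnegrE ?sqrtr_ge0// !rho_norm_sqr lerD2l.
by rewrite expr1n mul1r; apply: ler_peMl; [exact: sqr_ge0|exact: exprn_ege1].
Qed.

Lemma weak_limit i (x g : nat -> R3 R -> R[i]) u h :
  (forall n, L2 (x n)) -> L2 u -> L2 h -> (forall n, weak i (x n) (g n)) ->
  (fun n => norm (fun y => x n y - u y)) @ \oo --> 0 ->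
  (fun n => norm (fun y => g n y - h y)) @ \oo --> 0 -> weak i u h.
Proof.
move=> Lx Lu Lh xg xu gh; apply/weakE; split=> // phi tphi.
set p := fun x => (phi x)%:C; set q := fun x => (partial i phi x)%:C.
have Lp : L2 p := test_function_L2 oOmega bOmega tphi.
have Lq : L2 q := test_function_L2 oOmega bOmega (test_function_partial i tphi).
apply/eqP; rewrite -subr_eq0 opprK -cabs_eq0; apply/eqP.
apply: (@eq0_le_cvg0 _ _ (fun n => norm (fun y => x n y - u y) * norm q +
    norm (fun y => g n y - h y) * norm p)).
  have -> : 0 = 0 * norm q + 0 * norm p by rewrite !mul0r addr0.
  by apply: cvgD; apply: cvgMr_tmp.
move=> n; have Lg := (xg n).1; rewrite ger0_norm ?cabs_ge0//.
have /weakE[_ /(_ _ tphi) xgE] := xg n; case: (dotH) => ds _ _.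
have -> : dot u q + dot h p =
    - (dot (fun y => x n y - u y) q + dot (fun y => g n y - h y) p).
  rewrite (sesquilinearBl ds (Lx n) Lu Lq) (sesquilinearBl ds Lg Lh Lp) xgE.
  by move: (dot (g n) p) (dot u q) (dot h p) => p1 p2 p3; ring.
rewrite -mulN1r cabsM cabsN1 mul1r; apply: le_trans (cabsD _ _) _.
by rewrite lerD// -!hnorm_dot; apply: (hermitian_CauchySchwarz L2sub dotH) => //;
  exact: complex_subspaceB.
Qed.

Lemma H1_complete rho (x : nat -> R3 R -> R[i]) : 1 <= rho ->
  (forall n, H1 (x n)) ->
  (exists M, forall n,
     \sum_(k < n) rho_norm Omega rho (fun y => x k.+1 y - x k y) <= M) ->
  exists2 u, H1 u &
    (fun n => rho_norm Omega rho (fun y => x n y - u y)) @ \oo --> 0.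
Proof.
move=> rho1 Hx [M xM]; have Lx n := H1_L2 (Hx n).
have [|u Lu xu] := L2_complete mO Lx.
  exists M => n; apply: le_trans (xM n); apply: ler_sum => k _.
  exact: norm_le_rho_norm.
have /choice[g gP] : forall i, exists g, L2 g /\
    (fun n => norm (fun y => wp i (x n) y - g y)) @ \oo --> 0.
  move=> i; have [|g Lg xg] := L2_complete mO (fun n => weak_partial_L2 i (Hx n)).
    exists M => n; apply: le_trans (xM n); apply: ler_sum => k _.
    rewrite -/(norm _) -(norm_weak_partialB (Hx _) (Hx k) (weak_partialP i (Hx k))).
    exact: norm_weak_le_rho_norm.
  by exists g.
have ug i : weak i u (g i).
  by apply: (weak_limit Lx Lu _ (fun n => weak_partialP i (Hx n)) xu); case: (gP i).
have Hu : H1 u by split=> // i; exists (g i).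
exists u => //.
pose E n := \sum_(i < 3) norm (fun y => wp i (x n) y - g i y) ^+ 2 +
  rho ^+ 2 * norm (fun y => x n y - u y) ^+ 2.
have E0 : E @ \oo --> (0 : R).
  have sq0 (s : nat -> R) : s @ \oo --> 0 -> (fun n => s n ^+ 2) @ \oo --> (0 : R).
    move=> s0; under eq_fun do rewrite expr2.
    by rewrite -(mulr0 0); exact: (cvgM s0 s0).
  have : E @ \oo --> (0 + rho ^+ 2 * 0 : R).
    apply: cvgD; last by apply: cvgMl_tmp; exact: sq0.
    by apply: cvg_sum0 => i; apply: sq0; case: (gP i).
  by rewrite mulr0 addr0.
have -> : (fun n => rho_norm Omega rho (fun y => x n y - u y)) = Num.sqrt \o E.
  apply/funext => n; congr (Num.sqrt (_ + _)); apply: eq_bigr => i _.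
  by rewrite (norm_weak_partialB (g := g i)).
by rewrite -sqrtr0; exact: (cvg_comp _ _ E0 (@sqrt_continuous R 0)).
Qed.

Lemma closed_subspace_complete (S : set (R3 R -> R[i])) rho
    (x : nat -> R3 R -> R[i]) : closed_subspace Omega S -> 1 <= rho ->
  (forall n, S (x n)) ->
  (exists M, forall n,
     \sum_(k < n) hnorm (energy rho) (fun y => x k.+1 y - x k y) <= M) ->
  exists2 u, S u & (fun n => hnorm (energy rho) (fun y => x n y - u y)) @ \oo --> 0.
Proof.
move=> [SH _ _ Scl] rho1 Sx [M xM].
have [|u Hu xu] := H1_complete rho1 (fun n => SH _ (Sx n)).
  by exists M => n; under eq_bigr do rewrite rho_normE.
exists u; last by under eq_fun do rewrite -rho_normE.
apply: Scl => // eps e0.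
have /cvgrPdist_lt/(_ eps e0)[n _ /(_ n (leqnn n))] := xu.
rewrite /= sub0r normrN ger0_norm ?sqrtr_ge0// => lt; exists (x n) => //.
apply: le_lt_trans lt; apply: le_trans (rho_norm1_le _ rho1) _.
have Hx := SH _ (Sx n).
have := hnormZ H1_subspace (energy_hermitian rho) (-1)
  (complex_subspaceB H1_subspace Hu Hx).
rewrite cabsN1 mul1r -!rho_normE => <-.
rewrite le_eqVlt; apply/orP; left; apply/eqP; congr rho_norm.
by apply/funext => y; rewrite mulN1r opprB.
Qed.

End H1Space.

(** * The form a_zeta *)

Section Form.
Context {R : realType}.
Variable Omega : set (R3 R).
Hypothesis oOmega : open Omega.
Hypothesis bOmega : bounded_set Omega.
Variable tr : (R3 R -> R[i]) -> (R3 R -> R[i]).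
Hypothesis htr : trace_operator Omega tr.
Variable Cb : R.
Hypothesis hCb : forall (z : R[i]) (u v : R3 R -> R[i]),
  0 <= complex.Re z -> 1 <= cabs z -> H1 Omega u -> H1 Omega v ->
  cabs (z * dot_Gamma Omega (tr u) (tr v)) <=
    Cb * rho_norm Omega (cabs z) u * rho_norm Omega (cabs z) v.
Implicit Types (u v w f e : R3 R -> R[i]) (z : R[i]) (S : set (R3 R -> R[i])).

Local Notation L2 := (L2_Omega Omega).
Local Notation dot := (dot Omega).
Local Notation norm := (norm Omega).
Local Notation H1 := (H1 Omega).
Local Notation rnorm := (rho_norm Omega).
Local Notation form := (aform Omega tr).
Let mO := measurable_Omega oOmega.
Let L2sub : complex_subspace L2 := isL2_subspace (leb3 R) mO.
Let dotH : hermitian_nonneg_on L2 dot := L2dot_hermitian (leb3 R) mO.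
Let H1sub : complex_subspace H1 := H1_subspace oOmega bOmega.
Let enH rho : hermitian_nonneg_on H1 (energy Omega rho) :=
  energy_hermitian oOmega bOmega rho.

Definition dot_trace u v := dot_Gamma Omega (tr u) (tr v).

Lemma trace_hermitian : hermitian_nonneg_on H1 dot_trace.
Proof.
have [trL tr_lin _ _] := htr.
have GH : hermitian_nonneg_on (L2_Gamma Omega) (dot_Gamma Omega).
  exact: (L2dot_hermitian (surface_measure (frontier Omega)) measurableT).
have [[gl gr] gC g0] := GH.
have GD : forall a u v, L2_Gamma Omega u -> L2_Gamma Omega v ->
    L2_Gamma Omega (fun x => a * u x + v x).
  by case: (isL2_subspace (surface_measure (frontier Omega)) measurableT).
have [_ HD] := H1sub.
have linl a u v w : H1 u -> H1 v -> H1 w ->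
    dot_trace (fun x => a * u x + v x) w = a * dot_trace u w + dot_trace v w.
  move=> Hu Hv Hw.
  have Lu := trL _ Hu; have Lv := trL _ Hv; have Lw := trL _ Hw.
  rewrite -[RHS](gl a _ _ _ Lu Lv Lw).
  apply: (L2dot_ae_eql measurableT (trL _ (HD a _ _ Hu Hv)) (GD a _ _ Lu Lv) Lw).
  by apply: (ae_imply _ (tr_lin a u v Hu Hv)) => x -> _.
have dC u v : H1 u -> H1 v -> dot_trace v u = (dot_trace u v)^*.
  by move=> Hu Hv; exact: (gC _ _ (trL _ Hu) (trL _ Hv)).
split; [split; first exact: linl|exact: dC|].
- move=> a u v w Hu Hv Hw; have Hauv := HD a _ _ Hu Hv.
  by rewrite (dC _ _ Hauv Hw) linl// (dC u w)// (dC v w)// rmorphD rmorphM.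
- by move=> u Hu; exact: (g0 _ (trL _ Hu)).
Qed.

Lemma form_sesquilinear z : sesquilinear_on H1 (form z).
Proof.
have [[gl gr] _ _] := gdot_hermitian oOmega bOmega.
have [[dl dr] _ _] := dotH; have [[tl tr'] _ _] := trace_hermitian.
have comb (a p q r s t y k l : R[i]) :
    a * p + q + r * (a * s + t) + y * (a * k + l) =
    a * (p + r * s + y * k) + (q + r * t + y * l) by ring.
split=> a u v w Hu Hv Hw; rewrite /aform -!/(dot_trace _ _).
  rewrite (gl a u v w Hu Hv Hw) (tl a u v w Hu Hv Hw).
  by rewrite (dl a u v w (H1_L2 Hu) (H1_L2 Hv) (H1_L2 Hw)) comb.
rewrite (gr a u v w Hu Hv Hw) (tr' a u v w Hu Hv Hw).
by rewrite (dr a u v w (H1_L2 Hu) (H1_L2 Hv) (H1_L2 Hw)) comb.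
Qed.

Lemma form_conj z u v : H1 u -> H1 v -> form z^* v u = (form z u v)^*.
Proof.
move=> Hu Hv; have [_ gC _] := gdot_hermitian oOmega bOmega.
have [_ dC _] := dotH; have [_ tC _] := trace_hermitian.
have comb (p q r : R[i]) :
    conjc p + conjc z ^+ 2 * conjc q + conjc z * conjc r =
    conjc (p + z ^+ 2 * q + z * r).
  by rewrite !rmorphD !rmorphM.
rewrite /aform -!/(dot_trace _ _) (gC u v Hu Hv) (tC u v Hu Hv).
rewrite (dC u v (H1_L2 Hu) (H1_L2 Hv)); exact: comb.
Qed.

Lemma form_diag z u : H1 u -> form z u u =
  (hnorm (gdot Omega) u ^+ 2)%:C + z ^+ 2 * (norm u ^+ 2)%:C +
  z * (hnorm dot_trace u ^+ 2)%:C.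
Proof.
move=> Hu; rewrite /aform -!/(dot_trace _ _).
rewrite (hermitian_real (gdot_hermitian oOmega bOmega) Hu).
by rewrite (hermitian_real dotH (H1_L2 Hu)) (hermitian_real trace_hermitian Hu) hnorm_dot.
Qed.

Lemma rho_norm_sqr_gdot rho u : H1 u ->
  rnorm rho u ^+ 2 = hnorm (gdot Omega) u ^+ 2 + rho ^+ 2 * norm u ^+ 2.
Proof.
move=> Hu; rewrite rho_norm_sqr; congr (_ + _).
rewrite (hnorm_sqr (gdot_hermitian oOmega bOmega) Hu) /gdot raddf_sum.
apply: eq_bigr => i _; have Lw := weak_partial_L2 i Hu.
by rewrite -hnorm_dot (hnorm_sqr dotH Lw).
Qed.

(* [Re (conj z * a_z(u, u)) = Re z * (|grad u|^2 + |z|^2 |u|^2) + |z|^2 |tr u|^2] *)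
Lemma form_coercive z u : 0 <= complex.Re z -> H1 u ->
  complex.Re z * rnorm (cabs z) u ^+ 2 <= complex.Re (z^* * form z u u).
Proof.
move=> z0 Hu; rewrite rho_norm_sqr_gdot// form_diag// cabs_sqr.
move: (hnorm (gdot Omega) u) (norm u) (hnorm dot_trace u) => A B C.
case: z z0 => p q /= p0; rewrite -subr_ge0.
set lhs := (X in 0 <= X).
have -> : lhs = (p * C) ^+ 2 + (q * C) ^+ 2 by rewrite /lhs; ring.
by rewrite addr_ge0 ?sqr_ge0.
Qed.

Lemma form_bounded z u v : 0 <= complex.Re z -> 1 <= cabs z -> H1 u -> H1 v ->
  cabs (form z u v) <= (1 + Cb) * rnorm (cabs z) u * rnorm (cabs z) v.
Proof.
move=> z0 z1 Hu Hv; rewrite /aform -mulrA mulrDl mul1r [Cb * _]mulrA.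
apply: le_trans (cabsD _ _) _; apply: lerD; last exact: hCb.
apply: (@le_trans _ _ (cabs (gdot Omega u v) + cabs z ^+ 2 * cabs (dot u v))).
  by apply: le_trans (cabsD _ _) _; rewrite cabsM [z ^+ 2]expr2 cabsM -expr2.
have gH := gdot_hermitian oOmega bOmega.
have := hermitian_CauchySchwarz H1sub gH Hu Hv.
have := hermitian_CauchySchwarz L2sub dotH (H1_L2 Hu) (H1_L2 Hv).
have := rho_norm_sqr_gdot (cabs z) Hu; have := rho_norm_sqr_gdot (cabs z) Hv.
rewrite !hnorm_dot.
have : 0 <= hnorm (gdot Omega) u := sqrtr_ge0 _.
have : 0 <= hnorm (gdot Omega) v := sqrtr_ge0 _.
have : 0 <= norm u := sqrtr_ge0 _; have : 0 <= norm v := sqrtr_ge0 _.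
have : 0 <= rnorm (cabs z) u := sqrtr_ge0 _.
have : 0 <= rnorm (cabs z) v := sqrtr_ge0 _.
move: (hnorm (gdot Omega) u) (hnorm (gdot Omega) v) (norm u) (norm v)
  (rnorm (cabs z) u) (rnorm (cabs z) v) (cabs z) (cabs (gdot Omega u v))
  (cabs (dot u v)) => a a' b b' n n' k g d.
move=> n'0 n0 b'0 b0 a'0 a0 n'E nE db ga.
apply: (@le_trans _ _ (a * a' + k ^+ 2 * (b * b'))).
  by rewrite lerD// ler_wpM2l ?sqr_ge0.
have l0 : 0 <= a * a' + k ^+ 2 * (b * b').
  apply: addr_ge0; first exact: mulr_ge0.
  by apply: mulr_ge0; [exact: sqr_ge0|exact: mulr_ge0].
rewrite -ler_sqr ?nnegrE ?mulr_ge0// [leRHS]exprMn nE n'E -subr_ge0.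
set X := (X in 0 <= X).
have -> : X = (k * (a * b' - a' * b)) ^+ 2 by rewrite /X; ring.
exact: sqr_ge0.
Qed.

Lemma Cb_ge0 z v : 0 <= complex.Re z -> 1 <= cabs z -> H1 v ->
  rnorm (cabs z) v != 0 -> 0 <= Cb.
Proof.
move=> z0 z1 Hv v0; have := hCb z0 z1 Hv Hv.
move=> /(le_trans (cabs_ge0 _)); rewrite -mulrA -expr2 pmulr_lge0//.
by rewrite exprn_even_gt0.
Qed.

Lemma closed_subspace_complex S : closed_subspace Omega S -> complex_subspace S.
Proof. by case. Qed.

Lemma sesquilinear_sub S h : S `<=` H1 -> sesquilinear_on H1 h ->
  sesquilinear_on S h.
Proof.
move=> SH [hl hr]; split=> a u v w Su Sv Sw.
  exact: (hl a u v w (SH _ Su) (SH _ Sv) (SH _ Sw)).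
exact: (hr a u v w (SH _ Su) (SH _ Sv) (SH _ Sw)).
Qed.

Lemma energy_hermitian_sub S rho : S `<=` H1 ->
  hermitian_nonneg_on S (energy Omega rho).
Proof.
move=> SH; have [es eC e0] := enH rho; split.
- exact: sesquilinear_sub.
- by move=> u v Su Sv; exact: (eC u v (SH _ Su) (SH _ Sv)).
- by move=> u Su; exact: (e0 u (SH _ Su)).
Qed.

Lemma form_solvable S z F N : closed_subspace Omega S -> 0 < complex.Re z ->
  1 <= cabs z -> antilinear_on S F ->
  (forall v, S v -> cabs (F v) <= N * rnorm (cabs z) v) ->
  exists2 u, S u & forall v, S v -> form z u v = F v.
Proof.
move=> Scl z0 z1 Fl FN; have [SH _ _ _] := Scl.
have zn0 : z^* != 0.
  by rewrite -cabs_eq0 cabsJ gt_eqF// (lt_le_trans ltr01).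
apply: (complex_lax_milgram (closed_subspace_complex Scl)
  (energy_hermitian_sub (cabs z) SH)
  (fun x => @closed_subspace_complete _ _ oOmega bOmega S (cabs z) x Scl z1)
  (sesquilinear_sub SH (form_sesquilinear z)) Fl zn0 z0 (M := 1 + Cb) (N := N)).
- by move=> u Su; rewrite -rho_normE; exact: (form_coercive (ltW z0) (SH _ Su)).
- move=> u v Su Sv; rewrite -!rho_normE.
  exact: (form_bounded (ltW z0) z1 (SH _ Su) (SH _ Sv)).
- by move=> v Sv; rewrite -rho_normE; exact: FN.
Qed.

Lemma H1_closed_subspace : closed_subspace Omega H1.
Proof. by have [H0 HD] := H1sub; split. Qed.

Lemma Stilde_solution z f : 0 < complex.Re z -> 1 <= cabs z -> L2 f ->
  adjoint_solution Omega tr z f (Stilde Omega tr z f).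
Proof.
move=> z0 z1 Lf; apply: xgetPex.
have zJ0 : 0 < complex.Re z^* by case: z z0 {z1}.
have zJ1 : 1 <= cabs z^* by rewrite cabsJ.
have Fl : antilinear_on H1 (dot f).
  move=> a u v Hu Hv; have [[_ dr] _ _] := dotH.
  exact: (dr a u v f (H1_L2 Hu) (H1_L2 Hv) Lf).
have [|u Hu uP] := form_solvable (N := norm f) H1_closed_subspace zJ0 zJ1 Fl.
  move=> v Hv; apply: le_trans (hermitian_CauchySchwarz L2sub dotH Lf (H1_L2 Hv)) _.
  rewrite !hnorm_dot; apply: ler_wpM2l; first exact: norm_ge0.
  exact: norm_le_rho_norm.
by exists u.
Qed.

End Form.

(** * Quasi-optimality *)

Section BestError.
Context {R : realType}.
Variables (Omega : set (R3 R)) (zeta : R[i]) (S : set (R3 R -> R[i])).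
Implicit Types u v : R3 R -> R[i].

Local Notation dist u v := (rho_norm Omega (cabs zeta) (fun x => u x - v x)).

Lemma best_error_le u v : S v -> best_error Omega zeta S u <= dist u v.
Proof.
by move=> Sv; apply: ge_inf; [exists 0 => _ [w _ <-]; exact: sqrtr_ge0|exists v].
Qed.

Lemma le_best_error u v (c : R) : S v -> (forall w, S w -> c <= dist u w) ->
  c <= best_error Omega zeta S u.
Proof.
move=> Sv cS; apply: lb_le_inf; first by exists (dist u v), v.
by move=> _ [w Sw <-]; exact: cS.
Qed.

End BestError.

Section Galerkin.
Context {R : realType}.
Variable Omega : set (R3 R).
Hypothesis oOmega : open Omega.
Hypothesis bOmega : bounded_set Omega.
Variable tr : (R3 R -> R[i]) -> (R3 R -> R[i]).
Hypothesis htr : trace_operator Omega tr.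
Variable Cb : R.
Hypothesis hCb : forall (z : R[i]) (u v : R3 R -> R[i]),
  0 <= complex.Re z -> 1 <= cabs z -> H1 Omega u -> H1 Omega v ->
  cabs (z * dot_Gamma Omega (tr u) (tr v)) <=
    Cb * rho_norm Omega (cabs z) u * rho_norm Omega (cabs z) v.
Variable S : set (R3 R -> R[i]).
Hypothesis Scl : closed_subspace Omega S.
Variable zeta : R[i].
Hypothesis zeta1 : 1 <= cabs zeta.
Hypothesis zeta0 : 0 < complex.Re zeta.
Implicit Types (u v w e : R3 R -> R[i]).

Local Notation rnorm := (rho_norm Omega (cabs zeta)).
Local Notation form := (aform Omega tr zeta).
Local Notation galerkin := (galerkin_solution Omega tr zeta S).
Let SH : S `<=` H1 Omega. Proof. by case: Scl. Qed.
Let Ssub : complex_subspace S := closed_subspace_complex Scl.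
Let H1sub : complex_subspace (H1 Omega) := H1_subspace oOmega bOmega.
Let mO := measurable_Omega oOmega.
Let form_s : sesquilinear_on (H1 Omega) form :=
  form_sesquilinear oOmega bOmega htr zeta.

Lemma rho_norm_norm0 u : H1 Omega u -> norm Omega u = 0 -> rnorm u = 0.
Proof.
move=> Hu u0; apply/eqP; rewrite -sqrf_eq0 rho_norm_sqr u0 expr0n mulr0 addr0.
rewrite big1// => i _.
have := norm_weak_partial oOmega bOmega (weak_norm0 oOmega bOmega i (H1_L2 Hu) u0) Hu.
by under eq_fun do rewrite subr0; move=> ->; rewrite expr0n.
Qed.

Lemma form_subr u v w : H1 Omega u -> H1 Omega v -> H1 Omega w ->
  form w (fun x => u x - v x) = form w u - form w v.
Proof.
by move=> Hu Hv Hw; exact: (antilinearB (sesquilinear_antilinear form_s Hw) Hu Hv).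
Qed.

Lemma form_subl u v w : H1 Omega u -> H1 Omega v -> H1 Omega w ->
  form (fun x => u x - v x) w = form u w - form v w.
Proof. by move=> Hu Hv Hw; exact: (sesquilinearBl form_s Hu Hv Hw). Qed.

Lemma galerkin_exists u : H1 Omega u -> exists uS, galerkin u uS.
Proof.
move=> Hu.
have Fl : antilinear_on S (form u).
  by move=> a v w Sv Sw; exact: (form_s.2 a v w u (SH Sv) (SH Sw) Hu).
have [|uS SuS uSP] := form_solvable oOmega bOmega htr hCb
    (N := (1 + Cb) * rnorm u) Scl zeta0 zeta1 Fl.
  move=> v Sv.
  exact: (form_bounded oOmega bOmega hCb (ltW zeta0) zeta1 Hu (SH Sv)).
exists uS; split=> // v Sv.
by rewrite (form_subl Hu (SH SuS) (SH Sv)) uSP// subrr.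
Qed.

Lemma galerkin_unique u uS w : H1 Omega u -> galerkin u uS -> galerkin u w ->
  ae_eq_Omega Omega w uS.
Proof.
move=> Hu [SuS uSP] [Sw wP].
pose d x := w x - uS x.
have Sd : S d := complex_subspaceB Ssub Sw SuS.
have Hw := SH Sw; have HuS := SH SuS; have Hd := SH Sd.
have form0 : form d d = 0.
  have := uSP d Sd; have := wP d Sd.
  rewrite (form_subl Hu Hw Hd) (form_subl Hu HuS Hd).
  move=> /eqP; rewrite subr_eq0 => /eqP ->.
  by rewrite /d (form_subl Hw HuS Hd).
have := form_coercive oOmega bOmega htr (ltW zeta0) Hd.
rewrite form0 mulr0 pmulr_rle0// => d0.
have {}d0 : rnorm d = 0.
  by apply/eqP; rewrite -sqrf_eq0 eq_le d0 sqr_ge0.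
have n0 : norm Omega d = 0.
  apply/le_anti; rewrite norm_ge0 andbT -d0.
  exact: norm_le_rho_norm.
have /(L2norm_eq0 mO (H1_L2 Hd)) := n0.
apply: (ae_imply (T := R3meas R)) => x dx Ox.
by apply/eqP; rewrite -subr_eq0; apply/eqP; exact: dx.
Qed.

Lemma galerkin_error_form u uS v : H1 Omega u -> galerkin u uS -> S v ->
  let e := fun x => u x - uS x in form e (fun x => u x - v x) = form e e.
Proof.
move=> Hu [SuS uSP] Sv e.
have HuS := SH SuS; have Hv := SH Sv.
have He : H1 Omega e := complex_subspaceB H1sub Hu HuS.
rewrite (form_subr Hu Hv He) [in RHS]/e (form_subr Hu HuS He).
by rewrite (uSP v Sv) (uSP uS SuS).
Qed.

Lemma one_Cb_gt0 v : H1 Omega v -> rnorm v != 0 -> 0 < 1 + Cb.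
Proof.
by move=> Hv /(Cb_ge0 hCb (ltW zeta0) zeta1 Hv) Cb0; rewrite ltr_pwDl.
Qed.

Lemma cea u uS : H1 Omega u -> galerkin u uS ->
  rnorm (fun x => u x - uS x) <=
    cabs zeta / complex.Re zeta * (1 + Cb) * best_error Omega zeta S u.
Proof.
move=> Hu uSg; have [SuS uSP] := uSg.
set e := fun x => _.
have He : H1 Omega e := complex_subspaceB H1sub Hu (SH SuS).
have e_ge0 : 0 <= rnorm e := sqrtr_ge0 _.
have [e0|en0] := eqVneq (rnorm e) 0.
  have -> : best_error Omega zeta S u = 0.
    apply/le_anti/andP; split; first by rewrite -e0; exact: best_error_le.
    by apply: (le_best_error SuS) => w _; exact: sqrtr_ge0.
  by rewrite mulr0 e0.
have C0 := one_Cb_gt0 He en0.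
have e_gt0 : 0 < rnorm e by rewrite lt_def en0.
have z_gt0 : 0 < cabs zeta by exact: lt_le_trans zeta1.
have K0 : 0 < cabs zeta / complex.Re zeta * (1 + Cb) by rewrite mulr_gt0// divr_gt0.
rewrite -ler_pdivrMl//; apply: (le_best_error SuS) => v Sv.
have Huv : H1 Omega (fun x => u x - v x) := complex_subspaceB H1sub Hu (SH Sv).
rewrite ler_pdivrMl// -(ler_pM2l zeta0) -(ler_pM2r e_gt0).
rewrite -mulrA -expr2; apply: le_trans (form_coercive oOmega bOmega htr (ltW zeta0) He) _.
rewrite -(galerkin_error_form Hu uSg Sv).
apply: le_trans (ler_norm _) _; apply: le_trans (normr_Re_le _) _.
rewrite cabsM cabsJ.
have fb := form_bounded oOmega bOmega hCb (ltW zeta0) zeta1 He Huv.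
apply: le_trans (ler_wpM2l (ltW z_gt0) fb) _.
rewrite le_eqVlt; apply/orP; left; apply/eqP; field.
by rewrite gt_eqF.
Qed.

(* Aubin-Nitsche: with [z] the adjoint solution for the error [e] itself,
   [|e|^2 = conj (a_zeta(e, z)) = conj (a_zeta(e, z - v))] for all [v] in [S]. *)
Lemma aubin_nitsche u uS : H1 Omega u -> galerkin u uS ->
  ((norm Omega (fun x => u x - uS x)%R)%:E <=
    (1 + Cb)%:E * adjoint_approximability Omega tr zeta S *
    (rnorm (fun x => u x - uS x)%R)%:E)%E.
Proof.
move=> Hu uSg; set e := fun x => (u x - uS x)%R; have [SuS uSP] := uSg.
have He : H1 Omega e := complex_subspaceB H1sub Hu (SH SuS).
have Le := H1_L2 He.
have [e0|en0] := eqVneq (norm Omega e) 0.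
  by rewrite (rho_norm_norm0 He e0) e0 mule0.
have e_gt0 : 0 < norm Omega e by rewrite lt_def en0 norm_ge0.
have re_gt0 : 0 < rnorm e.
  by apply: lt_le_trans e_gt0 _; exact: norm_le_rho_norm.
have C0 : 0 < 1 + Cb by apply: (one_Cb_gt0 He); rewrite gt_eqF.
have [Hz zP] := Stilde_solution oOmega bOmega htr hCb zeta0 zeta1 Le.
set z := Stilde Omega tr zeta e in Hz zP.
have key : norm Omega e ^+ 2 / ((1 + Cb) * rnorm e) <= best_error Omega zeta S z.
  apply: (le_best_error SuS) => v Sv.
  rewrite ler_pdivrMr ?mulr_gt0//.
  have Hzv : H1 Omega (fun x => z x - v x) := complex_subspaceB H1sub Hz (SH Sv).
  have := form_bounded oOmega bOmega hCb (ltW zeta0) zeta1 He Hzv.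
  rewrite (form_subr Hz (SH Sv) He) (uSP v Sv) subr0.
  have -> : cabs (form e z) = norm Omega e ^+ 2.
    rewrite -cabsJ -(form_conj oOmega bOmega htr zeta He Hz) (zP e He).
    have dotH : hermitian_nonneg_on (L2_Omega Omega) (dot Omega).
      exact: (L2dot_hermitian (leb3 R) mO).
    rewrite (hermitian_real dotH Le) hnorm_dot /= expr0n addr0 sqrtr_sqr.
    by rewrite ger0_norm ?sqr_ge0.
  by rewrite mulrC.
have le_sup : ((best_error Omega zeta S z / norm Omega e)%:E <=
    adjoint_approximability Omega tr zeta S)%E.
  by apply: ereal_sup_ubound; exists e.
have C0' : (0 <= (1 + Cb)%:E)%E by rewrite lee_fin ltW.
have re0' : (0 <= (rnorm e)%:E)%E by rewrite lee_fin ltW.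
apply: le_trans (lee_wpmul2r re0' (lee_wpmul2l C0' le_sup)).
rewrite -!EFinM lee_fin.
have n1 : norm Omega e = (1 + Cb) * (norm Omega e ^+ 2 / ((1 + Cb) * rnorm e) /
    norm Omega e) * rnorm e.
  by field; rewrite !gt_eqF.
by rewrite {1}n1 ler_pM2r// ler_pM2l// ler_pM2r ?invr_gt0.
Qed.

End Galerkin.

Theorem theorem6p3 (R : realType) (Omega : set (R3 R))
    (hdom : bounded_domain Omega) (hanalytic : analytic_boundary Omega)
    (hstar : star_shaped_wrt_ball Omega)
    (tr : (R3 R -> R[i]) -> (R3 R -> R[i])) (htr : trace_operator Omega tr)
    (Cb : R)
    (hCb : forall (z : R[i]) (u v : R3 R -> R[i]),
       0 <= complex.Re z -> 1 <= cabs z -> H1 Omega u -> H1 Omega v ->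
       cabs (z * dot_Gamma Omega (tr u) (tr v)) <=
         Cb * rho_norm Omega (cabs z) u * rho_norm Omega (cabs z) v)
    (S : set (R3 R -> R[i])) (hS : closed_subspace Omega S)
    (zeta : R[i]) (hzeta : 1 <= cabs zeta) (hRe : 0 < complex.Re zeta)
    (u : R3 R -> R[i]) (hu : H1 Omega u) :
  exists uS : R3 R -> R[i],
    let e := fun x => u x - uS x in
    [/\ galerkin_solution Omega tr zeta S u uS,
        forall w, galerkin_solution Omega tr zeta S u w -> ae_eq_Omega Omega w uS,
        rho_norm Omega (cabs zeta) e <=
          cabs zeta / complex.Re zeta * (1 + Cb) * best_error Omega zeta S u
      & ((norm Omega e)%:E <=
          (1 + Cb)%:E * adjoint_approximability Omega tr zeta S *
            (rho_norm Omega (cabs zeta) e)%:E)%E].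
Proof.
have [_ oOmega _ bOmega] := hdom.
have [uS uSg] := galerkin_exists oOmega bOmega htr hCb hS hzeta hRe hu.
exists uS; split; first exact: uSg.
- by move=> w wg; exact: (galerkin_unique oOmega bOmega htr hS hzeta hRe hu uSg wg).
- exact: (cea oOmega bOmega htr hCb hS hzeta hRe hu uSg).
- exact: (aubin_nitsche oOmega bOmega htr hCb hS hzeta hRe hu uSg).
Qed.
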